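(* Let $K$ be a compact abelian group that contains a locally essential subgroup $G$ which is a radial space (in the subspace topology). Then $K$ is metrizable.
   Context: All topological groups are Hausdorff; subgroups carry the subspace topology. A subgroup $G$ of a topological group $H$ is called locally essential (in $H$) if there exists a neighborhood $V$ of $1$ in $H$ such that for every closed normal subgroup $N$ of $H$ contained in $V$, $G\cap N=\{1\}$ implies $N=\{1\}$. A topological space $X$ is radial if for every point $x$ in the closure of a subset $A$ of $X$ there exist a well-ordered set $(D,\le)$ and an indexed set $(a_d)_{d\in D}$ of points of $A$ such that the net $(a_d)_{d\in D}$ converges to $x$, i.e. for every open neighbourhood $U$ of $x$ there exists $c\in D$ such that $a_d\in U$ whenever $d\in D$ and $c\le d$. *)

(* Defs.v *)
From mathcomp Require Import all_boot all_order all_algebra.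
From mathcomp Require Import all_classical all_reals.
From mathcomp Require Import topology tvs.
From mathcomp Require wochoice.

Set Implicit Arguments.
Unset Strict Implicit.
Unset Printing Implicit Defensive.

Import Order.TTheory GRing.Theory Num.Theory.

Local Open Scope classical_set_scope.
Local Open Scope ring_scope.

(* Topological abelian groups are written additively. *)
Definition is_subgroup (K : zmodType) (G : set K) : Prop :=
  zmod_closed (mem G).

(* Every subgroup of an abelian group is normal, so the normality of N in the
   definition for arbitrary topological groups is omitted. *)
Definition locally_essential (K : topologicalZmodType) (G : set K) : Prop :=
  exists2 V : set K, nbhs (0 : K) V &
    forall N : set K, is_subgroup N -> closed N -> N `<=` V ->
      G `&` N = [set 0] -> N = [set 0].

(* well_order asks every nonempty subset to have a unique minimum, which makes
   le a (total) order.  Taking U := setT shows that D is nonempty. *)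
Definition radial (X : topologicalType) : Prop :=
  forall (A : set X) (x : X), closure A x ->
    exists (D : Type) (le : rel D) (a : D -> X),
      [/\ wochoice.well_order le, forall d, A (a d) &
          forall U : set X, open U -> U x ->
            exists c : D, forall d : D, le c d -> U (a d)].

Definition metrizable (R : realType) (X : topologicalType) : Prop :=
  exists (M : metricType R) (f : X -> M) (g : M -> X),
    [/\ cancel f g, cancel g f, continuous f & continuous g].

(* Main.v *)
From HB Require Import structures.
Require Import Defs.
From mathcomp Require Import all_boot all_order all_algebra.
From mathcomp Require Import all_classical all_reals.
From mathcomp Require Import topology normedtype sequences derive trigo tvs.
From mathcomp Require Import ring lra.

(** Write X for the group of continuous characters of K, that is, of continuous
    homomorphisms to the circle. The point is that X is countable
    ([dual_countable]); countably many characters separate the points of K, and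
    they give a metric, which by compactness defines the topology.

    Suppose that X is uncountable. Local essentiality provides finitely many
    characters whose common kernel lies in the given neighborhood V, so that
    every nonzero closed subgroup killed by these characters meets G outside 0.
    An uncountable abelian group maps onto a direct sum of uncountably many
    copies of Z(p) or of Z(p^oo), for some prime p, and the map can be chosen to
    kill the given finite set of characters ([uncountable_prufer_quotient]).
    Dually, K contains a product of uncountably many copies of Z(p) or of the
    p-adic integers, inside the common kernel. G contains a nonzero point g_b of
    the closed subgroup generated by the b-th coordinate vector; on an
    uncountable set I' of indices the p-adic valuations of these multiples have a
    common bound. It also contains a nonzero point x of the closed subgroup
    generated by the vector whose coordinates are 1 in I' and 0 elsewhere. Then a
    fixed multiple y of x lies in the closure of the group generated by the g_b,
    and all of its coordinates in I' are nonzero, while each element of that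
    group has only finitely many nonzero coordinates. No well-ordered net of points with finite supports converges to
    such a y: if each coordinate is nonzero eventually, then countably many
    members of the net suffice to see all the coordinates
    ([countable_eventual_support]).

    This needs Pontryagin duality for compact groups, in two forms.

    Characters separate points ([characters_separate]). An invariant mean on the
    bounded functions of the discrete group K comes from an ultrafilter on finite
    averages. For f continuous, the autocorrelation g of f is continuous and
    positive definite. Among all normalized positive definite functions, possibly
    discontinuous, a functional psi |-> corr v (g psi) that is perturbed to be
    strictly convex in finitely many coordinates is nearly maximal only at
    functions that nearly satisfy d'Alembert's equation
    c (x + a) + c (x - a) = 2 c x c a at these coordinates, as extreme points are
    characters; limits along the ultrafilter solve the equation
    ([cosine_exists]). Such a c correlates with g, which forces it to be
    continuous ([cosine_continuous]), and it is the real part of a character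
    ([character_of_cosine]).

    Every homomorphism from X to the circle is the evaluation at a point of K
    ([evaluation_surjective]). Twisting the characters that occur in a
    trigonometric polynomial by such a homomorphism does not change its mean;
    this is applied to large powers of a polynomial that peaks where finitely
    many characters take prescribed values. *)

Set Implicit Arguments.
Unset Strict Implicit.
Unset Printing Implicit Defensive.

Import Order.TTheory GRing.Theory Num.Theory.
Import numFieldNormedType.Exports.

Local Open Scope classical_set_scope.
Local Open Scope ring_scope.

(** * The circle group *)

Section Circle.
Variable R : realType.

(** The circle, with its group law written additively: the two coordinates are
    the cosine and the sine of an angle. *)
Record circle := Circle
  { circle_val : R * R; _ : circle_val.1 ^+ 2 + circle_val.2 ^+ 2 == 1 }.

HB.instance Definition _ := [isSub for circle_val].
HB.instance Definition _ := [Choice of circle by <:].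

Definition cre (t : circle) : R := (val t).1.
Definition cim (t : circle) : R := (val t).2.

Lemma cre_cim1 (t : circle) : cre t ^+ 2 + cim t ^+ 2 = 1.
Proof. exact/eqP/(valP t). Qed.

Lemma circle_ext (s t : circle) : cre s = cre t -> cim s = cim t -> s = t.
Proof.
move=> h1 h2; apply/val_inj/eqP; rewrite /cre /cim in h1 h2.
by case: (val s) (val t) h1 h2 => [a b] [c d] /= -> ->.
Qed.

Fact circle_subproof (c s : R) : c ^+ 2 + s ^+ 2 = 1 ->
  (c, s).1 ^+ 2 + (c, s).2 ^+ 2 == 1.
Proof. by move=> /= ->. Qed.

Definition mk_circle (c s : R) (h : c ^+ 2 + s ^+ 2 = 1) : circle :=
  Circle (circle_subproof h).

Fact circle_add_subproof (s t : circle) :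
  (cre s * cre t - cim s * cim t) ^+ 2 + (cim s * cre t + cre s * cim t) ^+ 2 = 1.
Proof.
transitivity ((cre s ^+ 2 + cim s ^+ 2) * (cre t ^+ 2 + cim t ^+ 2)); first by ring.
by rewrite !cre_cim1 mulr1.
Qed.

Fact circle_opp_subproof (t : circle) : cre t ^+ 2 + (- cim t) ^+ 2 = 1.
Proof. by rewrite sqrrN cre_cim1. Qed.

Fact circle_zero_subproof : 1 ^+ 2 + 0 ^+ 2 = 1 :> R.
Proof. by rewrite expr1n expr0n addr0. Qed.

Definition circle_add s t := mk_circle (circle_add_subproof s t).
Definition circle_opp t := mk_circle (circle_opp_subproof t).
Definition circle_zero := mk_circle circle_zero_subproof.

Let addE s t : (cre (circle_add s t) = cre s * cre t - cim s * cim t)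
  * (cim (circle_add s t) = cim s * cre t + cre s * cim t).
Proof. by []. Qed.

Fact circle_addA : associative circle_add.
Proof. by move=> a b c; apply: circle_ext; rewrite !addE; ring. Qed.
Fact circle_addC : commutative circle_add.
Proof. by move=> a b; apply: circle_ext; rewrite !addE; ring. Qed.
Let zeroE : (cre circle_zero = 1) * (cim circle_zero = 0).
Proof. by []. Qed.
Let oppE t : (cre (circle_opp t) = cre t) * (cim (circle_opp t) = - cim t).
Proof. by []. Qed.

Fact circle_add0 : left_id circle_zero circle_add.
Proof. by move=> a; apply: circle_ext; rewrite !addE !zeroE; ring. Qed.
Fact circle_addN : left_inverse circle_zero circle_opp circle_add.
Proof.
move=> a; apply: circle_ext; rewrite !addE !zeroE !oppE; last by ring.
by transitivity (cre a ^+ 2 + cim a ^+ 2); [ring | rewrite cre_cim1].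
Qed.

HB.instance Definition _ :=
  GRing.isZmodule.Build circle circle_addA circle_addC circle_add0 circle_addN.

Lemma creD (s t : circle) : cre (s + t) = cre s * cre t - cim s * cim t.
Proof. by []. Qed.
Lemma cimD (s t : circle) : cim (s + t) = cim s * cre t + cre s * cim t.
Proof. by []. Qed.
Lemma creN (t : circle) : cre (- t) = cre t. Proof. by []. Qed.
Lemma cimN (t : circle) : cim (- t) = - cim t. Proof. by []. Qed.
Lemma cre0 : cre 0 = 1. Proof. by []. Qed.
Lemma cim0 : cim 0 = 0. Proof. by []. Qed.

Lemma creM (s t : circle) : cre s * cre t = (cre (s + t) + cre (s - t)) / 2.
Proof. by rewrite !creD creN cimN; field. Qed.

Lemma cre_norm (t : circle) : `|cre t| <= 1.
Proof.
rewrite ler_norml; have := cre_cim1 t; have := sqr_ge0 (cim t); nra.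
Qed.

Lemma cre_le1 (t : circle) : cre t <= 1.
Proof. by have := cre_norm t; rewrite ler_norml => /andP[]. Qed.

Lemma cre_eq1 (t : circle) : cre t = 1 -> t = 0.
Proof.
move=> h; apply: circle_ext; first by rewrite h.
have := cre_cim1 t; rewrite h cim0 => e; apply/eqP; rewrite -sqrf_eq0; apply/eqP.
by lra.
Qed.

(** The squared chord length of t from 0 is 2(1 - cre t), so this is the
    inequality (u + v)^2 <= 2u^2 + 2v^2 for chords. *)
Lemma creD_defect (s t : circle) :
  1 - cre (s + t) <= 2 * (1 - cre s) + 2 * (1 - cre t).
Proof.
rewrite creD; have := cre_cim1 s; have := cre_cim1 t.
have := sqr_ge0 (cre s + cre t - 2); have := sqr_ge0 (cim s - cim t); nra.
Qed.

(** The increment is at most the chord between s and s + t, which is as long as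
    the one between 0 and t. *)
Lemma cre_lip (s t : circle) : (cre (s + t) - cre s) ^+ 2 <= 2 * (1 - cre t).
Proof.
rewrite creD; have := cre_cim1 s; have := cre_cim1 t.
have := sqr_ge0 (cim s * (cre t - 1) + cre s * cim t).
move=> h1 h2 h3.
suff : (cre s * cre t - cim s * cim t - cre s) ^+ 2
  + (cim s * (cre t - 1) + cre s * cim t) ^+ 2
  = (cre s ^+ 2 + cim s ^+ 2) * ((cre t ^+ 2 + cim t ^+ 2) + 1 - 2 * cre t).
  by rewrite h2 h3; lra.
by ring.
Qed.

Definition expi (x : R) : circle := mk_circle (cos2Dsin2 x).

Lemma expiD x y : expi (x + y) = expi x + expi y.
Proof.
apply: circle_ext; rewrite ?creD ?cimD /cre /cim /=; first by rewrite cosD.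
by rewrite sinD.
Qed.

Lemma expi0 : expi 0 = 0.
Proof. by apply: circle_ext; rewrite /cre /cim /= ?cos0 ?sin0. Qed.

Lemma expiMn x n : expi (x *+ n) = expi x *+ n.
Proof.
by elim: n => [|n IH]; rewrite ?mulr0n ?expi0 // !mulrS expiD IH.
Qed.

(** Compatible generators of the p^n-torsion subgroups, whose union is a copy of
    the Pruefer group Z(p^oo). *)
Definition troot (p n : nat) : circle := expi ((pi *+ 2) / (p ^ n)%:R).

Section Troot.
Variable p : nat.
Hypothesis p_pr : prime p.

Lemma troot0 : troot p 0 = 0.
Proof.
rewrite /troot expn0 divr1; apply: circle_ext; rewrite /cre /cim /=.
  by rewrite cos2pi.
by rewrite sin2pi.
Qed.

Lemma trootS n : troot p n.+1 *+ p = troot p n.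
Proof.
rewrite /troot -expiMn expnS natrM; congr expi.
rewrite -mulr_natr; field.
by rewrite !pnatr_eq0 -!lt0n expn_gt0 prime_gt0.
Qed.

Lemma troot_exp m n : troot p (m + n) *+ p ^ m = troot p n.
Proof.
elim: m => [|m IH]; first by rewrite expn0.
by rewrite addSn expnS mulrnA trootS.
Qed.

Lemma troot1_neq0 : troot p 1 != 0.
Proof.
apply/eqP => /(congr1 cre); rewrite /cre /= expn1 => h.
have p1 := prime_gt1 p_pr.
have p0 : 0 < p%:R :> R by rewrite ltr0n prime_gt0.
have p2 : 2 <= p%:R :> R by rewrite ler_nat.
have := pi_gt0 R => pi0.
have h1 : (0 : R) < pi *+ 2 / p%:R by rewrite divr_gt0 // pmulrn_lgt0.
have h2 : (pi *+ 2 / p%:R : R) <= pi.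
  by rewrite ler_pdivrMr // -[pi *+ 2]mulr_natr ler_wpM2l // ltW.
have : cos (pi *+ 2 / p%:R : R) < cos 0.
  by rewrite ltr_cos // !in_itv /= ?(ltW h1) ?h2 ?lexx ?(ltW pi0).
by rewrite h cos0 ltxx.
Qed.

(** By induction on n, from the case n = 1, where it is Bezout's identity. *)
Lemma troot_eq0 n m : (troot p n *+ m == 0) = (p ^ n %| m)%N.
Proof.
have ord n' : troot p n' *+ p ^ n' = 0 by have := troot_exp n' 0; rewrite addn0 troot0.
have one m' : troot p 1 *+ m' = 0 -> (p %| m')%N.
  move=> h; apply/negPn/negP => npm.
  have cop : coprime p m' by rewrite prime_coprime.
  have m'0 : (0 < m')%N by case: m' npm {h cop} => //; rewrite dvdn0.
  case: (egcdnP p m'0) => km kn E _.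
  move: E; rewrite gcdnC; move/eqP: cop => -> E.
  have := troot1_neq0; rewrite -[X in X != _]mulr1n => /negP; apply.
  have e : troot p 1 *+ (km * m') = troot p 1 *+ (kn * p + 1) by rewrite E.
  move: e; rewrite mulrnDr mulnC (mulnC kn) !mulrnA h mul0rn.
  by rewrite -[p in troot p 1 *+ p]expn1 ord mul0rn add0r => <-.
apply/idP/idP => [/eqP|/dvdnP[k ->]]; last by rewrite mulnC mulrnA ord mul0rn.
elim: n m => [|n IH] m h; first by rewrite expn0 dvd1n.
have : (p ^ n %| m)%N.
  by apply: IH; rewrite -trootS -mulrnA mulnC mulrnA h mul0rn.
case/dvdnP => k E; move: h; rewrite E mulnC mulrnA -addn1 troot_exp => /one.
by case/dvdnP => k' ->; rewrite addn1 expnSr dvdn_mul ?dvdn_mull.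
Qed.

End Troot.
End Circle.

(** * Limits along an ultrafilter, and an invariant mean *)

Definition bounded (R : realType) (I : Type) (u : I -> R) : Prop :=
  exists B : R, forall i, `|u i| <= B.

Section Bounded.
Variables (R : realType) (I : Type).
Implicit Types u v : I -> R.

Lemma bounded_cst a : bounded (fun _ : I => a : R).
Proof. by exists `|a|. Qed.

Lemma boundedD u v : bounded u -> bounded v -> bounded (fun i => u i + v i).
Proof.
move=> [B hB] [C hC]; exists (B + C) => i.
by rewrite (le_trans (ler_normD _ _)) // lerD.
Qed.

Lemma boundedM u v : bounded u -> bounded v -> bounded (fun i => u i * v i).
Proof.
move=> [B hB] [C hC]; exists (B * C) => i; rewrite normrM.
by apply: ler_pM.
Qed.

Lemma boundedZ a u : bounded u -> bounded (fun i => a * u i).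
Proof. by move=> hu; apply: boundedM => //; exact: bounded_cst. Qed.

Lemma boundedN u : bounded u -> bounded (fun i => - u i).
Proof. by move=> [B hB]; exists B => i; rewrite normrN. Qed.

Lemma boundedB u v : bounded u -> bounded v -> bounded (fun i => u i - v i).
Proof. by move=> hu hv; apply: boundedD => //; exact: boundedN. Qed.

Lemma bounded_comp (J : Type) (h : J -> I) u : bounded u -> bounded (u \o h).
Proof. by move=> [B hB]; exists B => i; exact: hB. Qed.

Lemma bounded_sum (A : Type) (s : seq A) (u : A -> I -> R) :
  (forall a, bounded (u a)) -> bounded (fun i => \sum_(a <- s) u a i).
Proof.
move=> hu; elim: s => [|a s IH].
  by exists 0 => i; rewrite big_nil normr0.
have [B hB] := boundedD (hu a) IH.
by exists B => i; rewrite big_cons; exact: hB.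
Qed.

Lemma boundedX n u : bounded u -> bounded (fun i => u i ^+ n).
Proof.
by move=> [B hB]; exists (B ^+ n) => i; rewrite normrX lerXn2r ?nnegrE
  ?normr_ge0 // (le_trans _ (hB i)).
Qed.

End Bounded.

Section UltraLimit.
Variables (R : realType) (I : Type) (U : set_system I).
Context {UU : UltraFilter U}.
Implicit Types u v : I -> R.

Definition ulim u : R := lim (u @ U).

Lemma ulim_cvg u : bounded u -> u @ U --> ulim u.
Proof.
move=> [B hB].
have cB : compact `[- B, B] := @segment_compact R (- B) B.
have uB : (u @ U) [set` `[- B, B]].
  by apply: (@filterE _ U) => i /=; rewrite in_itv /= -ler_norml.
have [p [_ clp]] := cB _ _ uB.
suff : u @ U --> p by move=> h; rewrite /ulim (cvg_lim _ h).
move=> W pW; have [//|hn] := in_ultra_setVsetC (u @^-1` W) UU.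
by have [x [nW Wx]] := clp (~` W) W hn pW.
Qed.

Lemma ulim_uniq u l : u @ U --> l -> ulim u = l.
Proof. by move=> h; exact: cvg_lim. Qed.

Lemma ulim_cst a : ulim (fun=> a) = a.
Proof. by apply: ulim_uniq; exact: cvg_cst. Qed.

Lemma ulimD u v : bounded u -> bounded v ->
  ulim (fun i => u i + v i) = ulim u + ulim v.
Proof. by move=> hu hv; apply: ulim_uniq; apply: cvgD; exact: ulim_cvg. Qed.

Lemma ulimM u v : bounded u -> bounded v ->
  ulim (fun i => u i * v i) = ulim u * ulim v.
Proof. by move=> hu hv; apply: ulim_uniq; apply: cvgM; exact: ulim_cvg. Qed.

Lemma ulimZ a u : bounded u -> ulim (fun i => a * u i) = a * ulim u.
Proof. by move=> hu; rewrite ulimM ?ulim_cst //; exact: bounded_cst. Qed.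

Lemma ulim_sum (A : Type) (s : seq A) (u : A -> I -> R) :
  (forall a, bounded (u a)) ->
  ulim (fun i => \sum_(a <- s) u a i) = \sum_(a <- s) ulim (u a).
Proof.
move=> hu; elim: s => [|a s IH].
  rewrite big_nil -[RHS]ulim_cst; congr ulim; apply/funext => i.
  by rewrite big_nil.
rewrite big_cons -IH -ulimD //; last exact: bounded_sum.
by congr ulim; apply/funext => i; rewrite big_cons.
Qed.

Lemma ulim_le u v : bounded u -> bounded v ->
  (\forall i \near U, u i <= v i) -> ulim u <= ulim v.
Proof.
move=> hu hv uv; rewrite -subr_ge0.
rewrite leNgt; apply/negP => lt0.
have vu : \forall i \near U, (v - u) i < 0.
  by have := cvgr_lt _ (cvgB (ulim_cvg hv) (ulim_cvg hu)) _ lt0; apply.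
have : U ([set i | u i <= v i] `&` [set i | (v - u) i < 0]) by exact: filterI.
move=> /filter_ex[i [/=]]; rewrite subr_lt0.
by move=> h1 /(le_lt_trans h1); rewrite ltxx.
Qed.

Lemma ulim_ge u a : bounded u -> (\forall i \near U, a <= u i) -> a <= ulim u.
Proof.
move=> hu h; rewrite -[a]ulim_cst; apply: ulim_le => //; exact: bounded_cst.
Qed.

Lemma ulim_le_cst u a : bounded u -> (\forall i \near U, u i <= a) -> ulim u <= a.
Proof.
move=> hu h; rewrite -[a]ulim_cst; apply: ulim_le => //; exact: bounded_cst.
Qed.

Lemma ulim_norm u B : (forall i, `|u i| <= B) -> `|ulim u| <= B.
Proof.
move=> h; have hu : bounded u by exists B.
rewrite ler_norml ulim_ge ?ulim_le_cst //;
  by apply: filterE => i; have := h i; rewrite ler_norml => /andP[].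
Qed.

End UltraLimit.

Section Average.
Variables (R : realType) (K : zmodType).
Implicit Types (v w : seq K) (f g : K -> R).

(** The point 0 is always included, so that every list, even the empty one,
    gives a probability measure. *)
Definition avg v f : R := (\sum_(x <- 0 :: v) f x) / (size v).+1%:R.

Lemma avg_ext v f g : f =1 g -> avg v f = avg v g.
Proof. by move=> /funext ->. Qed.

Lemma avgD v f g : avg v (fun x => f x + g x) = avg v f + avg v g.
Proof. by rewrite /avg big_split mulrDl. Qed.

Lemma avgZ v a f : avg v (fun x => a * f x) = a * avg v f.
Proof. by rewrite /avg -mulr_sumr mulrA. Qed.

Lemma avg_cst v a : avg v (fun=> a) = a.
Proof.
rewrite /avg big_const_seq count_predT iter_addr_0 -[a *+ _]mulr_natr mulfK //.
by rewrite pnatr_eq0.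
Qed.

Lemma avg_le v f g : (forall x, f x <= g x) -> avg v f <= avg v g.
Proof.
by move=> h; rewrite /avg ler_pM2r ?invr_gt0 ?ltr0n // ler_sum.
Qed.

Lemma avg_norm v f B : (forall x, `|f x| <= B) -> `|avg v f| <= B.
Proof.
move=> h; rewrite ler_norml -{1}(avg_cst v (- B)) -{2}(avg_cst v B).
by rewrite !avg_le // => x; have := h x; rewrite ler_norml => /andP[].
Qed.

Lemma avgC v w (h : K -> K -> R) :
  avg v (fun x => avg w (h x)) = avg w (fun y => avg v (h^~ y)).
Proof.
rewrite /avg -!mulr_suml exchange_big /= -!mulrA; congr (_ * _).
exact: mulrC.
Qed.

Lemma avg_conv v w : exists u, forall f,
  avg u f = avg v (fun x => avg w (fun y => f (x + y))).
Proof.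
exists (behead [seq x + y | x <- 0 :: v, y <- 0 :: w]) => f.
rewrite /avg -mulr_suml.
have -> : 0 :: behead [seq x + y | x <- 0 :: v, y <- 0 :: w]
    = [seq x + y | x <- 0 :: v, y <- 0 :: w] by rewrite /= addr0.
rewrite big_allpairs_dep -mulrA -invfM -natrM; congr (_ / _%:R).
by rewrite size_behead size_allpairs /= mulnC mulnS mulSn.
Qed.

End Average.

Section Mean.
Variables (R : realType) (K : zmodType).
Implicit Types f g : K -> R.

(** Indices carry, besides a measure, a finite set of points and an integer:
    the same ultrafilter is used for limits of approximate solutions of
    d'Alembert's equation. Going further along the filter means convolving the
    measure with others. *)
Let index : Type := (seq K * seq K * nat)%type.

Let cone (j : index) : set index := [set i : index |
  [/\ exists w, forall f : K -> R, avg i.1.1 f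
        = avg j.1.1 (fun x => avg w (fun y => f (x + y))),
      {subset j.1.2 <= i.1.2} & (j.2 <= i.2)%N]].

Let cone_filter : ProperFilter (filter_from [set: index] cone).
Proof.
apply: filter_from_proper => [|j _]; last first.
  exists j; split => //; exists [::] => f; apply: avg_ext => x.
  by rewrite /avg /= big_seq1 divr1 addr0.
apply: filter_from_filter; first by exists (([::], [::], 0) : index).
move=> [[v S] n] [[w S'] n'] _ _.
have [u hu] := avg_conv R v w; exists (u, S ++ S', maxn n n') => //.
move=> [[z Z] m] [/= [t ht] sS nm]; split; split => /=.
- have [u' hu'] := avg_conv R w t.
  exists u' => f; rewrite ht hu; apply: avg_ext => x.
  by rewrite hu'; apply: avg_ext => y; apply: avg_ext => k; rewrite addrA.
- by move=> x xS; apply: sS; rewrite mem_cat xS.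
- by rewrite (leq_trans _ nm) // leq_maxl.
- have [u' hu'] := avg_conv R v t.
  exists u' => f; rewrite ht hu avgC; apply: avg_ext => x.
  by rewrite hu'; apply: avg_ext => y; apply: avg_ext => k; rewrite addrA (addrC x).
- by move=> x xS; apply: sS; rewrite mem_cat xS orbT.
- by rewrite (leq_trans _ nm) // leq_maxr.
Qed.

Definition avg_ultra : set_system (seq K * seq K * nat) :=
  sval (cid (ultraFilterLemma cone_filter)).

#[global] Instance avg_ultra_filter : UltraFilter avg_ultra.
Proof. by rewrite /avg_ultra; case: cid => /= ? []. Qed.

Lemma near_avg_ultra (v S : seq K) (n : nat) : \forall j \near avg_ultra,
  [/\ exists w, forall f : K -> R, avg j.1.1 f
        = avg v (fun x => avg w (fun y => f (x + y))),
      {subset S <= j.1.2} & (n <= j.2)%N].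
Proof.
rewrite /avg_ultra; case: cid => /= G [_ FG]; apply: FG.
by exists (v, S, n).
Qed.

Definition mean (f : K -> R) : R := ulim avg_ultra (fun j => avg j.1.1 f).

Let bounded_avg f : bounded f ->
  bounded (fun j : index => avg j.1.1 f).
Proof. by move=> [B hB]; exists B => j; exact: avg_norm. Qed.

Lemma mean_cst a : mean (fun=> a) = a.
Proof.
rewrite -[RHS](@ulim_cst R _ avg_ultra _); congr ulim.
by apply/funext => j; rewrite avg_cst.
Qed.

Lemma meanD f g : bounded f -> bounded g ->
  mean (fun x => f x + g x) = mean f + mean g.
Proof.
move=> hf hg; rewrite /mean -ulimD; try exact: bounded_avg.
by congr ulim; apply/funext => j; rewrite avgD.
Qed.

Lemma meanZ a f : bounded f -> mean (fun x => a * f x) = a * mean f.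
Proof.
move=> hf; rewrite /mean -ulimZ; last exact: bounded_avg.
by congr ulim; apply/funext => j; rewrite avgZ.
Qed.

Lemma meanB f g : bounded f -> bounded g ->
  mean (fun x => f x - g x) = mean f - mean g.
Proof.
move=> hf hg; rewrite meanD //; last exact: boundedN.
rewrite -mulN1r -meanZ //; congr (_ + mean _); apply/funext => x.
by rewrite mulN1r.
Qed.

Lemma mean_sum (A : Type) (s : seq A) (u : A -> K -> R) :
  (forall a, bounded (u a)) ->
  mean (fun x => \sum_(a <- s) u a x) = \sum_(a <- s) mean (u a).
Proof.
move=> hu; elim: s => [|a s IH].
  rewrite big_nil -[RHS]mean_cst; congr mean; apply/funext => i.
  by rewrite big_nil.
rewrite big_cons -IH -meanD //; last exact: bounded_sum.
by congr mean; apply/funext => i; rewrite big_cons.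
Qed.

Lemma mean_le f g : bounded f -> bounded g -> (forall x, f x <= g x) ->
  mean f <= mean g.
Proof.
move=> hf hg h; apply: ulim_le; try exact: bounded_avg.
by near=> j; exact: avg_le.
Unshelve. all: by end_near. Qed.

Lemma mean_ge0 f : bounded f -> (forall x, 0 <= f x) -> 0 <= mean f.
Proof.
by move=> hf h; rewrite -(mean_cst 0); apply: mean_le => //; exact: bounded_cst.
Qed.

Lemma mean_norm f B : (forall x, `|f x| <= B) -> `|mean f| <= B.
Proof. by move=> h; apply: ulim_norm => j; exact: avg_norm. Qed.

(** Averaging over 0, a, ..., na makes translation by a visible only at the two
    end points of this progression. *)
Lemma mean_shift a f : bounded f -> mean (fun x => f (x + a)) = mean f.
Proof.
move=> hf; have hfa : bounded (fun x => f (x + a)) by exact: (bounded_comp (+%R^~ a) hf).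
apply/eqP; rewrite -subr_eq0 -meanB // -normr_eq0; apply/eqP/le_anti.
rewrite normr_ge0 andbT; have [B hB] := hf.
have B0 : 0 <= B by rewrite (le_trans _ (hB 0)).
apply/ler_addgt0Pr => e e0; rewrite add0r.
have [n hn] : exists n, 2 * B <= e * n.+1%:R.
  exists (Num.truncn (2 * B / e)); rewrite [e * _]mulrC -ler_pdivrMr // ltW //.
  exact: truncnS_gt.
rewrite -(@ulim_cst R _ avg_ultra _ e) /mean.
have hb : bounded (fun j : index => avg j.1.1 (fun x => f (x + a) - f x)).
  by apply: bounded_avg; exact: boundedB.
apply: (@le_trans _ _ (ulim avg_ultra
   (fun j => `|avg j.1.1 (fun x => f (x + a) - f x)|))).
  have hb' : bounded (fun j : index => `|avg j.1.1 (fun x => f (x + a) - f x)|).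
    by have [C hC] := hb; exists C => j; rewrite normr_id.
  rewrite ler_norml; apply/andP; split.
    rewrite -mulN1r -ulimZ //; apply: ulim_le => //; first exact: boundedZ.
    by near=> j; rewrite mulN1r lerNl -normrN ler_norm.
  by apply: ulim_le => //; near=> j; exact: ler_norm.
apply: ulim_le; last first.
- have := near_avg_ultra [seq a *+ i | i <- iota 1 n] [::] 0.
  apply: filterS => -[[v S] m] /= [[w hw] _ _]; rewrite hw avgC.
  apply: avg_norm => y; rewrite /avg size_map size_iota.
  have -> : 0 :: [seq a *+ i | i <- iota 1 n] = [seq a *+ i | i <- iota 0 n.+1].
    by [].
  rewrite big_map -[iota 0 n.+1]/(index_iota 0 n.+1).
  under eq_bigr => i _ do rewrite addrAC -mulrSr.
  rewrite (telescope_sumr (fun i => f (a *+ i + y))) // mulr0n.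
  rewrite normrM normfV [`|n.+1%:R|]ger0_norm // ler_pdivrMr ?ltr0n //.
  rewrite (le_trans _ hn) // (le_trans (ler_normB _ _)) //.
  by rewrite mulrDl !mul1r lerD.
- exact: bounded_cst.
- by have [C hC] := hb; exists C => j; rewrite normr_id.
Unshelve. all: by end_near. Qed.

End Mean.

(** * Cosine characters *)

Section PositiveDefinite.
Variables (R : realType) (K : zmodType).
Implicit Types (v w u : seq K) (g h psi : K -> R).

Definition pos_def h := forall s : seq (R * K),
  0 <= \sum_(a <- s) \sum_(b <- s) a.1 * b.1 * h (a.2 - b.2).

Lemma pos_defD h g : pos_def h -> pos_def g -> pos_def (fun x => h x + g x).
Proof.
move=> ph pg s; rewrite (le_trans (addr_ge0 (ph s) (pg s))) // -big_split /=.
apply: ler_sum => a _; rewrite -big_split /=; apply: ler_sum => b _.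
by rewrite mulrDr.
Qed.

Lemma pos_defZ c h : 0 <= c -> pos_def h -> pos_def (fun x => c * h x).
Proof.
move=> c0 ph s; rewrite (le_trans (mulr_ge0 c0 (ph s))) // mulr_sumr.
apply: ler_sum => a _; rewrite mulr_sumr; apply: ler_sum => b _.
by rewrite mulrCA.
Qed.

Lemma pos_def_norm h x : pos_def h -> (forall y, h (- y) = h y) ->
  `|h x| <= h 0.
Proof.
move=> ph eh; rewrite ler_norml.
have := ph [:: (1, x); (1, 0)]; have := ph [:: (1, x); (-1, 0)].
rewrite !big_cons !big_nil /= !subrr !subr0 !sub0r !eh; lra.
Qed.

Definition shift_mean (a : K) h : K -> R := fun x => (h (x + a) + h (x - a)) / 2.

(** The form of h at a family of vectors plus e times its translate by a is twice
    the form of this function at the family itself. *)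
Lemma pos_def_shift a e h : e ^+ 2 = 1 -> pos_def h ->
  pos_def (fun x => h x + e * shift_mean a h x).
Proof.
move=> e1 ph s; have := ph (s ++ [seq (e * p.1, p.2 + a) | p <- s]).
rewrite big_cat /= big_map /=.
under eq_bigr do rewrite big_cat big_map /=.
under [X in _ + X]eq_bigr do rewrite big_cat big_map /=.
rewrite !big_split /= => H.
rewrite -(@pmulr_rge0 _ 2) // (le_trans H) // le_eqVlt; apply/orP; left.
apply/eqP; rewrite mulr_sumr -!big_split /=; apply: eq_bigr => p _.
rewrite mulr_sumr -!big_split /=; apply: eq_bigr => q _.
rewrite /shift_mean.
have -> : p.2 - (q.2 + a) = p.2 - q.2 - a by rewrite opprD addrA.
have -> : p.2 + a - q.2 = p.2 - q.2 + a by rewrite addrAC.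
have -> : p.2 + a - (q.2 + a) = p.2 - q.2 by rewrite opprD addrACA subrr addr0.
have -> : e * p.1 * (e * q.1) * h (p.2 - q.2)
  = e ^+ 2 * p.1 * q.1 * h (p.2 - q.2) by ring.
by rewrite e1; field.
Qed.

(** If v is thought of as a measure, [corr v h] integrates h against v
    convolved with its reflection. *)
Definition corr v h : R := avg v (fun x => avg v (fun y => h (x - y))).

Lemma corrE v h :
  corr v h = (\sum_(x <- 0 :: v) \sum_(y <- 0 :: v) h (x - y))
             / ((size v).+1%:R ^+ 2).
Proof. by rewrite /corr /avg -mulr_suml -mulrA -invfM expr2. Qed.

Lemma corrD v h g : corr v (fun x => h x + g x) = corr v h + corr v g.
Proof. by rewrite /corr -avgD; apply: avg_ext => x; rewrite avgD. Qed.

Lemma corrZ v c h : corr v (fun x => c * h x) = c * corr v h.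
Proof. by rewrite /corr -avgZ; apply: avg_ext => x; rewrite avgZ. Qed.

Lemma corr_le v h g : (forall x, h x <= g x) -> corr v h <= corr v g.
Proof. by move=> hg; apply: avg_le => x; apply: avg_le. Qed.

Lemma corr_cst v c : corr v (fun=> c) = c.
Proof. by rewrite /corr !avg_cst. Qed.

(** Translates of a vector have the same norm, so an average of translates
    cannot have a larger one. *)
Lemma corr_conv_le u v w h : pos_def h -> (forall y, h (- y) = h y) ->
  (forall f : K -> R, avg u f = avg v (fun x => avg w (fun y => f (x + y)))) ->
  corr u h <= corr v h.
Proof.
move=> ph eh huvw.
have -> : corr u h = avg w (fun x' => avg w (fun y' =>
    avg v (fun x => avg v (fun y => h (x + x' - (y + y')))))).
  rewrite /corr huvw avgC; apply: avg_ext => x'; rewrite [RHS]avgC.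
  apply: avg_ext => x; rewrite huvw avgC; apply: avg_ext => y' //.
rewrite -(avg_cst w (corr v h)); apply: avg_le => x'.
rewrite -(avg_cst w (corr v h)); apply: avg_le => y'.
rewrite corrE /avg -mulr_suml -mulrA -invfM -expr2.
rewrite ler_pM2r ?invr_gt0 ?exprn_gt0 ?ltr0n //.
rewrite -subr_ge0; move: (0 :: v) => s; set D := _ - _.
have := ph ([seq (1, x + x') | x <- s] ++ [seq (-1, x + y') | x <- s]).
rewrite big_cat !big_map /=.
under eq_bigr do rewrite big_cat !big_map /=.
under [X in _ + X]eq_bigr do rewrite big_cat !big_map /=.
rewrite !big_split /= [X in _ + (X + _)]exchange_big /=.
have e1 z : \sum_(x <- s) \sum_(y <- s) 1 * 1 * h (x + z - (y + z))
    = \sum_(x <- s) \sum_(y <- s) h (x - y).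
  apply: eq_bigr => x _; apply: eq_bigr => y _.
  by rewrite !mul1r opprD addrACA subrr addr0.
have e2 z : \sum_(x <- s) \sum_(y <- s) -1 * -1 * h (x + z - (y + z))
    = \sum_(x <- s) \sum_(y <- s) h (x - y).
  apply: eq_bigr => x _; apply: eq_bigr => y _.
  by rewrite mulrNN !mul1r opprD addrACA subrr addr0.
have e3 : \sum_(x <- s) \sum_(y <- s) 1 * -1 * h (x + x' - (y + y'))
    = - \sum_(x <- s) \sum_(y <- s) h (x + x' - (y + y')).
  rewrite -sumrN; apply: eq_bigr => x _; rewrite -sumrN; apply: eq_bigr => y _.
  by rewrite mul1r mulN1r.
have e4 : \sum_(x <- s) \sum_(y <- s) -1 * 1 * h (y + y' - (x + x'))
    = - \sum_(x <- s) \sum_(y <- s) h (x + x' - (y + y')).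
  rewrite -sumrN; apply: eq_bigr => x _; rewrite -sumrN; apply: eq_bigr => y _.
  by rewrite mulr1 mulN1r -eh opprB.
rewrite /D e1 e2 e3 e4; lra.
Qed.

End PositiveDefinite.

Section Cosine.
Variables (R : realType) (K : zmodType).
Implicit Types (v w u S : seq K) (g h psi : K -> R).

(** These functions form a compact convex set, whose extreme points are the
    real parts of characters. *)
Definition normalized psi :=
  [/\ pos_def psi, forall y, psi (- y) = psi y & psi 0 = 1].

Lemma normalized_norm psi x : normalized psi -> `|psi x| <= 1.
Proof. by move=> [p e <-]; exact: pos_def_norm. Qed.

(** For e = 1 and e = -1 these two functions have psi as a convex combination.
    The factor 1/2 keeps the denominators away from 0. *)
Lemma normalized_shift psi a (e : R) : normalized psi -> e ^+ 2 = 1 ->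
  normalized (fun x => (psi x + e / 2 * shift_mean a psi x)
                       / (1 + e / 2 * psi a)).
Proof.
move=> npsi e1; have [ppsi epsi psi0] := npsi.
have ha : 0 < 1 + e / 2 * psi a.
  have := normalized_norm a npsi; rewrite ler_norml => /andP[].
  by move: e1; rewrite expr2; nra.
have sm y : shift_mean a psi (- y) = shift_mean a psi y.
  by rewrite /shift_mean -epsi opprD opprK -[in X in _ + X]epsi opprB opprK addrC
    (addrC a).
split=> [|y|].
- have := pos_defZ (_ : 0 <= (1 + e / 2 * psi a)^-1)
    (pos_defD (pos_defZ (_ : 0 <= 2^-1) ppsi)
              (pos_defZ (_ : 0 <= 2^-1) (pos_def_shift a e1 ppsi))).
  rewrite !invr_ge0 ler0n ltW // => /(_ isT isT isT) H.
  congr (pos_def _) : H; apply/funext => x; rewrite mulrC; congr (_ / _).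
  by rewrite /shift_mean; field.
- by rewrite epsi sm.
- rewrite /shift_mean add0r sub0r epsi psi0.
  have -> : (psi a + psi a) / 2 = psi a by field.
  by rewrite divff // gt_eqF.
Qed.

(** Maximize J psi = corr v (g psi) + eta * (sum of psi b ^ 2 over b in S) up to
    eta * eps. As J is strictly convex in the coordinates in S, the splitting of
    [normalized_shift] must almost fix the value at a, and this says that
    psi (2a) is almost 2 (psi a)^2 - 1. *)
Lemma almost_cosine g v S (eta eps G : R) psi0 :
    0 < eta -> 0 < eps -> (forall x, `|g x| <= G) -> normalized psi0 ->
  exists psi, [/\ normalized psi,
    corr v (fun x => g x * psi0 x) - eta * (size S)%:R - eta * eps
      <= corr v (fun x => g x * psi x) &
    forall a, a \in S ->
      ((psi (a + a) + 1) / 2 - psi a ^+ 2) ^+ 2 <= 4 * eps].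
Proof.
move=> eta0 eps0 gG n0.
have G0 : 0 <= G by rewrite (le_trans _ (gG 0)).
pose J psi := corr v (fun x => g x * psi x) + eta * \sum_(b <- S) psi b ^+ 2.
pose A : set R := [set J psi | psi in normalized].
have sq_le psi : normalized psi -> \sum_(b <- S) psi b ^+ 2 <= (size S)%:R.
  move=> np; rewrite -[(size S)%:R]mulr1 mulr_natl -[1 *+ _]addr0 -iter_addr.
  rewrite -[size S](count_predT S) -big_const_seq.
  apply: ler_sum => b _; rewrite -(real_normK (num_real (psi b))).
  by rewrite expr_le1 // normalized_norm.
have Aub : ubound A (G + eta * (size S)%:R).
  move=> _ [psi np <-]; rewrite lerD //; last by rewrite ler_pM2l // sq_le.
  rewrite -[leRHS](corr_cst v); apply: corr_le => x.
  rewrite (le_trans (ler_norm _)) // normrM -[G]mulr1.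
  by rewrite ler_pM // normalized_norm.
have supA : has_sup A by split; [exists (J psi0), psi0 | exists (G + eta * (size S)%:R)].
have [_ [psi np <-] hJ] := sup_adherent (mulr_gt0 eta0 eps0) supA.
have le_sup psi' : normalized psi' -> J psi' <= sup A.
  by move=> np'; apply: ub_le_sup; [case: supA | exists psi'].
exists psi; split => //.
  have := le_sup _ n0.
  have : 0 <= \sum_(b <- S) psi0 b ^+ 2 by apply: sumr_ge0 => b _; exact: sqr_ge0.
  have := sq_le _ np; rewrite -(ler_pM2l eta0) /J in hJ *.
  move=> h1 h2; have := mulr_ge0 (ltW eta0) h2; move: h1 hJ; rewrite /J; lra.
move=> a aS.
have [ppsi epsi psi1] := np.
set t := psi a; set w := (psi (a + a) + 1) / 2.
have /andP[tm1 t1] : -1 <= t <= 1 by rewrite -ler_norml normalized_norm.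
pose lam (e : R) := (1 + e / 2 * t) / 2.
pose pert (e : R) := fun x => (psi x + e / 2 * shift_mean a psi x)
                              / (1 + e / 2 * psi a).
have np1 : normalized (pert 1) by apply: normalized_shift; rewrite ?expr1n.
have np2 : normalized (pert (-1)).
  by apply: normalized_shift; rewrite // sqrrN expr1n.
have d1 : 1 + 1 / 2 * t != 0 by rewrite gt_eqF //; lra.
have d2 : 1 + -1 / 2 * t != 0 by rewrite gt_eqF //; lra.
have mix x : lam 1 * pert 1 x + lam (-1) * pert (-1) x = psi x.
  rewrite /lam /pert -/t.
  have E (y d : R) : d != 0 -> d / 2 * (y / d) = y / 2 by move=> d0; field.
  by rewrite !E //; field.
have mixJ : lam 1 * J (pert 1) + lam (-1) * J (pert (-1)) = J psi
    + eta * (lam 1 * lam (-1) * \sum_(b <- S) (pert 1 b - pert (-1) b) ^+ 2).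
  have -> : J psi = lam 1 * corr v (fun x => g x * pert 1 x)
      + lam (-1) * corr v (fun x => g x * pert (-1) x)
      + eta * \sum_(b <- S) psi b ^+ 2.
    rewrite -!corrZ -corrD /J; congr (corr v _ + _); apply/funext => x.
    by rewrite -mix; ring.
  rewrite /J !mulrDr addrACA -!addrA; congr (_ + (_ + _)).
  rewrite mulrCA [lam (-1) * _]mulrCA -!mulrDr; congr (_ * _).
  rewrite !mulr_sumr -!big_split /=; apply: eq_bigr => b _.
  by rewrite -mix /lam; field.
have l1 : 0 < lam 1 by rewrite /lam; lra.
have l2 : 0 < lam (-1) by rewrite /lam; lra.
have l12 : 0 < lam 1 * lam (-1) by exact: mulr_gt0.
have gap : lam 1 * lam (-1) * (pert 1 a - pert (-1) a) ^+ 2 <= eps.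
  rewrite -(ler_pM2l eta0).
  apply: (@le_trans _ _ (eta * (lam 1 * lam (-1) *
      \sum_(b <- S) (pert 1 b - pert (-1) b) ^+ 2))).
    rewrite ler_pM2l // ler_pM2l // (big_rem a) //= lerDl.
    by apply: sumr_ge0 => b _; exact: sqr_ge0.
  have h1 := le_sup _ np1; have h2 := le_sup _ np2.
  have : lam 1 * J (pert 1) + lam (-1) * J (pert (-1)) <= sup A.
    have -> : sup A = lam 1 * sup A + lam (-1) * sup A by rewrite /lam; field.
    by rewrite lerD // ler_pM2l.
  by rewrite mixJ; move: hJ; lra.
have saE : shift_mean a psi a = w by rewrite /shift_mean subrr psi1.
have t4 : 0 < 1 - t ^+ 2 / 4 by nra.
have gapE : lam 1 * lam (-1) * (pert 1 a - pert (-1) a) ^+ 2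
    = (w - t ^+ 2) ^+ 2 / 4 / (1 - t ^+ 2 / 4).
  rewrite /lam /pert saE -/t; field.
  rewrite gt_eqF /=; last by nra.
  by apply/andP; split; rewrite gt_eqF //; lra.
move: gap; rewrite gapE ler_pdivrMr // => gap.
have : eps * (1 - t ^+ 2 / 4) <= eps by nra.
by move: gap; lra.
Qed.

End Cosine.

Section CosineExists.
Variables (R : realType) (K : zmodType).
Implicit Types (v w u S : seq K) (g h psi c : K -> R).

(** d'Alembert's equation, satisfied by the real parts of characters. *)
Definition dAlembert c := forall x a, c (x + a) + c (x - a) = 2 * (c x * c a).

(** The doubling formula is the equality case of a Cauchy-Schwarz inequality. *)
Lemma dAlembert_of_double c : normalized c ->
  (forall a, c (a + a) = 2 * c a ^+ 2 - 1) -> dAlembert c.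
Proof.
move=> [pc ec c0] h x a.
(* The vector e_a + e_{-a} - 2 c(a) e_0 is null for the form defined by c,
   hence orthogonal to e_x. *)
pose D := c (x + a) + c (x - a) - 2 * (c x * c a).
have key e : 0 <= 2 * e * D + e ^+ 2.
  have := pc [:: (1, a); (1, - a); (- (2 * c a), 0); (e, x)].
  rewrite !big_cons !big_nil /= !subrr !subr0 !sub0r !opprK.
  have -> : c (- a - a) = c (a + a) by rewrite -opprD ec.
  have -> : c (- a - x) = c (x + a) by rewrite -opprD ec addrC.
  have -> : c (a - x) = c (x - a) by rewrite -ec opprB.
  rewrite !ec c0 h /D; congr (_ <= _); ring.
have D0 : D = 0.
  apply/eqP; rewrite -sqrf_eq0 eq_le sqr_ge0 andbT.
  by have := key (- D); rewrite sqrrN; nra.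
by move: D0; rewrite /D => /eqP; rewrite subr_eq0 => /eqP.
Qed.

(** The limit of almost maximal functions for the indices (v, S, n), where eta
    and eps tend to 0 as S and n grow. The bound at a fixed measure survives
    because correlations decrease under convolution. *)
Lemma cosine_exists g psi0 (d G : R) :
    0 < d -> (forall x, `|g x| <= G) -> (forall x, g (- x) = g x) ->
    (forall psi, pos_def psi -> pos_def (fun x => g x * psi x)) ->
    normalized psi0 -> (forall v, d <= corr v (fun x => g x * psi0 x)) ->
  exists c, [/\ normalized c, dAlembert c &
    forall v, d / 2 <= corr v (fun x => g x * c x)].
Proof.
move=> d0 gG eg kg n0 hd.
pose eta (j : seq K * seq K * nat) : R := d / (2 * (size j.1.2).+1%:R).
pose eps (j : seq K * seq K * nat) : R := (j.2).+1%:R^-1.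
have eta0 j : 0 < eta j by rewrite divr_gt0 // mulr_gt0 // ltr0n.
have eps0 j : 0 < eps j by rewrite invr_gt0 ltr0n.
have /choice[p hp] j := almost_cosine j.1.1 j.1.2 (eta0 j) (eps0 j) gG n0.
have pn j : normalized (p j) by have [] := hp j.
have pb x : bounded (fun j => p j x) by exists 1 => j; exact: normalized_norm.
pose c x := ulim (@avg_ultra R K) (fun j => p j x).
have ub (A : Type) (s : seq A) (k : A -> R) (y : A -> K) :
    bounded (fun j => \sum_(a <- s) k a * p j (y a)).
  by apply: (@bounded_sum R _ A s (fun a j => k a * p j (y a))) => a;
    exact: boundedZ.
have uq (A : Type) (s : seq A) (k : A -> R) (y : A -> K) :
    \sum_(a <- s) k a * c (y a)
    = ulim (@avg_ultra R K) (fun j => \sum_(a <- s) k a * p j (y a)).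
  rewrite ulim_sum => [|a]; last exact: boundedZ.
  by apply: eq_bigr => a _; rewrite ulimZ.
have nc : normalized c.
  split => [s|y|].
  - have -> : \sum_(a <- s) \sum_(b <- s) a.1 * b.1 * c (a.2 - b.2)
      = ulim (@avg_ultra R K)
         (fun j => \sum_(a <- s) \sum_(b <- s) a.1 * b.1 * p j (a.2 - b.2)).
      rewrite ulim_sum => [|a]; last first.
        exact: (ub _ s (fun b => a.1 * b.1) (fun b => a.2 - b.2)).
      apply: eq_bigr => a _.
      by rewrite (uq _ s (fun b => a.1 * b.1) (fun b => a.2 - b.2)).
    apply: ulim_ge.
      apply: (@bounded_sum R _ _ s
        (fun a j => \sum_(b <- s) a.1 * b.1 * p j (a.2 - b.2))) => a.
      exact: (ub _ s (fun b => a.1 * b.1) (fun b => a.2 - b.2)).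
    by apply: filterE => j; have [pj _ _] := pn j; exact: pj.
  - by rewrite /c; congr ulim; apply/funext => j; have [_ e _] := pn j.
  - rewrite -[RHS](@ulim_cst R _ (@avg_ultra R K)) /c; congr ulim.
    by apply/funext => j; have [_ _ e] := pn j.
exists c; split => //.
  apply: dAlembert_of_double => // a.
  pose D := (c (a + a) + 1) / 2 - c a ^+ 2.
  pose Dj j := (p j (a + a) + 1) / 2 - p j a ^+ 2.
  have Dbj : bounded Dj.
    apply: boundedB; last exact: boundedX.
    apply: boundedM; last exact: bounded_cst.
    by apply: boundedD => //; exact: bounded_cst.
  have DE : D ^+ 2 = ulim (@avg_ultra R K) (fun j => Dj j ^+ 2).
    have -> : (fun j => Dj j ^+ 2) = (fun j => Dj j * Dj j).
      by apply/funext => j; rewrite expr2.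
    rewrite ulimM // -expr2; congr (_ ^+ 2); rewrite /D /c expr2 -ulimM //.
    have -> : Dj = (fun j => 2^-1 * p j (a + a) + (2^-1 + (-1) * (p j a * p j a))).
      by apply/funext => j; rewrite /Dj; field.
    have bM : bounded (fun j => p j a * p j a) by exact: boundedM.
    have bN : bounded (fun j => -1 * (p j a * p j a)) by exact: boundedZ.
    rewrite ulimD; [|exact: boundedZ|by apply: boundedD => //; exact: bounded_cst].
    rewrite ulimD //; last exact: bounded_cst.
    by rewrite ulim_cst !ulimZ //; field.
  have D0 : D ^+ 2 <= 0.
    apply/ler_addgt0Pr => e e0; rewrite add0r DE.
    apply: ulim_le_cst; first exact: boundedX.
    have := near_avg_ultra R [::] [:: a] (Num.truncn (4 / e)).
    apply: filterS => j [_ aS nj]; have [_ _ /(_ a)] := hp j.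
    rewrite aS ?mem_head // => /(_ isT) /le_trans; apply.
    rewrite /eps ler_pdivrMr ?ltr0n // mulrC -ler_pdivrMr //.
    by rewrite (le_trans (ltW (truncnS_gt _))) // ler_nat.
  have : D = 0 by apply/eqP; rewrite -sqrf_eq0 eq_le D0 sqr_ge0.
  by rewrite /D; lra.
move=> v.
have cE : corr v (fun x => g x * c x)
    = ulim (@avg_ultra R K) (fun j => corr v (fun x => g x * p j x)).
  have -> : (fun j => corr v (fun x => g x * p j x)) = (fun j =>
      ((size v).+1%:R ^+ 2)^-1
      * \sum_(x <- 0 :: v) \sum_(y <- 0 :: v) g (x - y) * p j (x - y)).
    by apply/funext => j; rewrite corrE mulrC.
  rewrite corrE.
  have ubx x := ub _ (0 :: v) (fun y => g (x - y)) (fun y => x - y).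
  rewrite mulrC ulimZ; last first.
    exact: (@bounded_sum R _ _ (0 :: v)
      (fun x j => \sum_(y <- 0 :: v) g (x - y) * p j (x - y))).
  congr (_ * _); rewrite ulim_sum //.
  apply: eq_bigr => x _.
  by rewrite (uq _ (0 :: v) (fun y => g (x - y)) (fun y => x - y)).
rewrite cE; apply: ulim_ge.
  exists G => j; rewrite /corr; apply: avg_norm => x; apply: avg_norm => y.
  by rewrite normrM -[G]mulr1 ler_pM // normalized_norm.
have := near_avg_ultra R v [::] 0; apply: filterS => j [[w hw] _ _].
have [[pj ej _] hj _] := hp j.
have := @corr_conv_le _ _ j.1.1 v w (fun x => g x * p j x) (kg _ pj) _ hw.
rewrite ?ej; move=> /(_ (fun y => congr2 *%R (eg y) (ej y))); apply: le_trans.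
apply: le_trans hj.
have := hd j.1.1; set X := corr _ _; move=> hX.
have : eta j * (size j.1.2)%:R + eta j * eps j <= d / 2.
  apply: (@le_trans _ _ (eta j * (size j.1.2).+1%:R)).
    rewrite -addn1 natrD mulrDr lerD2l ler_pM2l // invf_le1 ?ltr0n //.
    by rewrite ler1n.
  by rewrite /eta le_eqVlt; apply/orP; left; apply/eqP; field; rewrite addrC natr1 pnatr_eq0.
by move: hX; lra.
Qed.

End CosineExists.

(** * Compact abelian groups have enough cosines *)

Lemma compact_seq_cover (T : topologicalType) (A : set T) (I : eqType)
    (O : I -> set T) : compact A ->
    (forall x, A x -> exists i, nbhs x (O i)) ->
  exists s : seq I, forall x, A x -> exists2 i, i \in s & O i x.
Proof.
move=> cA hO; apply: contrapT => hs.
pose B (s : seq I) := [set x | A x /\ forall i, i \in s -> ~ O i x].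
have FB : ProperFilter (filter_from [set: seq I] B).
  apply: filter_from_proper; first apply: filter_from_filter.
  - by exists [::].
  - move=> s t _ _; exists (s ++ t) => // x [Ax h].
    by split; split => // i hi; apply: h; rewrite mem_cat hi ?orbT.
  - move=> s _; apply: contrapT => h; apply: hs; exists s => x Ax.
    apply: contrapT => h'; apply: h; exists x; split => // i si Oi.
    by apply: h'; exists i.
have FA : filter_from [set: seq I] B A by exists [::] => // y [].
have [x [Ax clx]] := cA _ FB FA; have [i Oi] := hO x Ax.
have FBi : filter_from [set: seq I] B (B [:: i]) by exists [:: i].
have [y [[_ h] Oy]] := clx _ _ FBi Oi.
by apply: h Oy; rewrite mem_head.
Qed.

Section TopologicalGroup.
Variables (K : topologicalZmodType).

Lemma nbhs_shift (a : K) (U : set K) : nbhs (0 : K) U -> nbhs a [set x | U (x - a)].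
Proof.
move=> U0; have := @sub_continuous K (a, a) U; rewrite /= subrr => /(_ U0) [[B1 B2] [/= h1 h2] h].
apply: filterS h1 => x B1x; apply: (h (x, a)); split => //=.
exact: nbhs_singleton h2.
Qed.

Lemma nbhs_translate (a : K) (U : set K) : nbhs a U -> nbhs (0 : K) [set x | U (a + x)].
Proof.
move=> Ua; have := @add_continuous K (a, 0) U; rewrite /= addr0 => /(_ Ua) [[B1 B2] [/= h1 h2] h].
apply: filterS h2 => x B2x; apply: (h (a, x)); split => //=.
exact: nbhs_singleton h1.
Qed.

Lemma nbhs0_sub (U : set K) : nbhs (0 : K) U ->
  exists2 W, nbhs (0 : K) W & forall x y, W x -> W y -> U (x - y).
Proof.
move=> U0; have := @sub_continuous K (0, 0) U; rewrite /= subrr => /(_ U0) [[B1 B2] [/= h1 h2] h].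
exists (B1 `&` B2); first exact: filterI.
by move=> x y [x1 x2] [y1 y2]; apply: (h (x, y)).
Qed.

End TopologicalGroup.

Section CompactGroup.
Variables (R : realType) (K : topologicalZmodType).
Hypothesis K_compact : compact [set: K].
Implicit Types (f g h phi : K -> R).

Lemma cover_translates (W : set K) : nbhs (0 : K) W ->
  exists s : seq K, forall x, exists2 t, t \in s & W (x - t).
Proof.
move=> W0.
have [|s hs] := @compact_seq_cover K setT K (fun t => [set x | W (x - t)]) K_compact.
  by move=> x _; exists x; exact: nbhs_shift.
by exists s => x; exact: hs.
Qed.

Lemma le_sum_seq (I : eqType) (s : seq I) (F : I -> R) i :
  (forall j, 0 <= F j) -> i \in s -> F i <= \sum_(j <- s) F j.
Proof.
by move=> F0 si; rewrite (big_rem i) //= lerDl sumr_ge0.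
Qed.

(** Finitely many translates of h have a sum of at least c. *)
Lemma mean_gt0 h (a : K) c : bounded h -> (forall x, 0 <= h x) -> 0 < c ->
  nbhs a [set x | c <= h x] -> 0 < mean h.
Proof.
move=> hb h0 c0 /nbhs_translate W0; have [s hs] := cover_translates W0.
have : c <= (size s)%:R * mean h.
  rewrite -[leLHS](@mean_cst R K).
  apply: (@le_trans _ _ (mean (fun x => \sum_(t <- s) h (x + (a - t))))).
    apply: mean_le => [||x]; first exact: bounded_cst.
      apply: (@bounded_sum R K K s (fun t x => h (x + (a - t)))) => t.
      exact: (bounded_comp (+%R^~ (a - t)) hb).
    have [t st ht] := hs x; rewrite (le_trans ht) //.
    rewrite (_ : a + (x - t) = x + (a - t)); last by rewrite addrCA.
    by apply: (@le_sum_seq _ s (fun t => h (x + (a - t)))).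
  rewrite (@mean_sum R K K s (fun t x => h (x + (a - t)))) => [|t]; last first.
    exact: (bounded_comp (+%R^~ (a - t)) hb).
  under eq_bigr do rewrite mean_shift //.
  by rewrite big_const_seq count_predT iter_addr_0 mulr_natl.
move=> /(lt_le_trans c0); rewrite pmulr_rgt0 // ltr0n.
by have [t] := hs 0; case: (s).
Qed.

(** Let k translates of W cover K, where h >= c on W - W. The translates have
    measure 1/k on average, and the square of the measure of each of them, times
    c, bounds the correlation from below. *)
Lemma corr_gt0 h c : (forall x, 0 <= h x) -> 0 < c ->
  nbhs (0 : K) [set x | c <= h x] ->
  exists2 d, 0 < d & forall v, d <= corr v h.
Proof.
move=> h0 c0 /nbhs0_sub[W W0 hW]; have [s hs] := cover_translates W0.
have k0 : 0 < (size s)%:R :> R.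
  by rewrite ltr0n; have [t] := hs 0; case: (s).
have [k kE] : exists k : R, k = (size s)%:R by exists (size s)%:R.
rewrite -kE in k0; exists (c / k ^+ 2) => [|v]; first by rewrite divr_gt0 // exprn_gt0.
have sumc (b : R) : \sum_(t <- s) b = k * b.
  by rewrite kE big_const_seq count_predT iter_addr_0 mulr_natl.
pose ind t x : R := (`[< W (x - t) >] : nat)%:R.
have sq t : c * avg v (ind t) ^+ 2 <= corr v h.
  have -> : c * avg v (ind t) ^+ 2
      = avg v (fun x => avg v (fun y => c * ind t x * ind t y)).
    transitivity (avg v (fun x => c * avg v (ind t) * ind t x)).
      by rewrite avgZ; ring.
    by apply: avg_ext => x; rewrite avgZ; ring.
  apply: avg_le => x; apply: avg_le => y.
  rewrite /ind; case: asboolP => wx; case: asboolP => wy;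
    rewrite ?mulr0 ?mul0r ?mulr1 ?mul1r //.
  by have := hW _ _ wx wy; rewrite /= opprB addrA subrK.
have one : 1 <= \sum_(t <- s) avg v (ind t).
  rewrite -[leLHS](@avg_cst R K v) /avg -mulr_suml ler_pM2r ?invr_gt0 ?ltr0n //.
  rewrite exchange_big /=; apply: ler_sum => x _.
  have [t st Wt] := hs x.
  rewrite (le_trans _ (@le_sum_seq _ s (fun t => ind t x) t _ st)) //.
  by rewrite /ind asboolT.
have : \sum_(t <- s) (c * (2 / k * avg v (ind t) - k^-1 ^+ 2))
    <= \sum_(t <- s) corr v h.
  apply: ler_sum => t _; apply: le_trans (sq t); rewrite ler_pM2l // -subr_ge0.
  have -> : avg v (ind t) ^+ 2 - (2 / k * avg v (ind t) - k^-1 ^+ 2)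
    = (avg v (ind t) - k^-1) ^+ 2 by field; rewrite gt_eqF.
  exact: sqr_ge0.
rewrite -mulr_sumr sumrB -mulr_sumr !sumc => H.
rewrite -(ler_pM2l k0); apply: le_trans H.
have -> : k * (c / k ^+ 2) = c * (2 / k * 1 - k * k^-1 ^+ 2).
  by field; rewrite gt_eqF.
rewrite ler_pM2l // lerD2r ler_pM2l //; exact: divr_gt0.
Qed.

Lemma unif_continuous_shift f (e : R) : continuous f -> 0 < e ->
  \forall x \near (0 : K), forall z, `|f (z + x) - f z| < e.
Proof.
move=> cf e0.
suff : \forall x \near (0 : K), [set: K] `<=` (fun z => `|f (z + x) - f z| < e).
  by apply: filterS => x hx z; exact: hx.
move/compact_near_coveringP: K_compact.
move=> /(_ K (nbhs (0 : K)) (fun x z => `|f (z + x) - f z| < e) _).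
apply => z _.
have e2 : 0 < e / 2 by rewrite divr_gt0.
have cz : nbhs z [set y | `|f z - f y| < e / 2].
  by move/cvgrPdist_lt: (cf z) => /(_ _ e2).
have := @add_continuous K (z, 0) [set y | `|f z - f y| < e / 2].
rewrite /= addr0 => /(_ cz).
case=> -[B1 B2] [/= h1 h2] h.
exists (B1 `&` [set y | `|f z - f y| < e / 2], B2).
  by split => //=; exact: filterI.
move=> [y x] /= [[B1y hy] B2x].
have := h (y, x) (conj B1y B2x) => /= hyx.
rewrite -(subrKA (f z)) (le_lt_trans (ler_normD _ _)) // [e]splitr ltrD //.
by rewrite distrC.
Qed.

End CompactGroup.

Section PeterWeyl.
Variables (R : realType) (K : topologicalZmodType).
Hypothesis K_hausdorff : hausdorff_space K.
Hypothesis K_compact : compact [set: K].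
Implicit Types (f g h phi c : K -> R).

Definition autocorr f : K -> R := fun x => mean (fun y => f (x + y) * f y).

Section Autocorr.
Variable f : K -> R.
Hypothesis f1 : forall x, `|f x| <= 1.

Let fb (a : K) : bounded (fun y => f (a + y)).
Proof. by exists 1 => y. Qed.

Let fb0 : bounded f.
Proof. by exists 1. Qed.

Lemma autocorr_norm x : `|autocorr f x| <= 1.
Proof. by apply: mean_norm => y; rewrite normrM -[1]mulr1 ler_pM. Qed.

Lemma autocorr_even x : autocorr f (- x) = autocorr f x.
Proof.
rewrite /autocorr -[LHS](mean_shift x); last exact: boundedM.
by congr mean; apply/funext => y; rewrite addrCA addNr addr0 mulrC addrC.
Qed.

Lemma autocorr_sub x y :
  autocorr f (x - y) = mean (fun z => f (x + z) * f (y + z)).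
Proof.
rewrite /autocorr -[LHS](mean_shift y); last exact: boundedM.
congr mean; apply/funext => z.
by rewrite [z + y]addrC addrA subrK.
Qed.

Lemma pos_def_autocorr psi : pos_def psi ->
  pos_def (fun x => autocorr f x * psi x).
Proof.
move=> ppsi s.
have fM (a b : R * K) :
    bounded (fun z => a.1 * f (a.2 + z) * (b.1 * f (b.2 + z)) * psi (a.2 - b.2)).
  apply: boundedM; last exact: bounded_cst.
  by apply: boundedM; exact: boundedZ.
have fS (a : R * K) : bounded (fun z => \sum_(b <- s)
    a.1 * f (a.2 + z) * (b.1 * f (b.2 + z)) * psi (a.2 - b.2)).
  exact: (@bounded_sum R K _ s (fun b z =>
    a.1 * f (a.2 + z) * (b.1 * f (b.2 + z)) * psi (a.2 - b.2))).
have -> : \sum_(a <- s) \sum_(b <- s)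
      a.1 * b.1 * (autocorr f (a.2 - b.2) * psi (a.2 - b.2))
    = mean (fun z => \sum_(a <- s) \sum_(b <- s)
      a.1 * f (a.2 + z) * (b.1 * f (b.2 + z)) * psi (a.2 - b.2)).
  rewrite (@mean_sum R K _ s (fun a z => \sum_(b <- s)
    a.1 * f (a.2 + z) * (b.1 * f (b.2 + z)) * psi (a.2 - b.2))) //.
  apply: eq_bigr => a _; rewrite (@mean_sum R K _ s (fun b z =>
    a.1 * f (a.2 + z) * (b.1 * f (b.2 + z)) * psi (a.2 - b.2))) //.
  apply: eq_bigr => b _; rewrite autocorr_sub.
  have -> : (fun z => a.1 * f (a.2 + z) * (b.1 * f (b.2 + z)) * psi (a.2 - b.2))
      = (fun z => a.1 * b.1 * psi (a.2 - b.2) * (f (a.2 + z) * f (b.2 + z))).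
    by apply/funext => z; ring.
  by rewrite meanZ; [ring|exact: boundedM].
apply: mean_ge0 => [|z].
  exact: (@bounded_sum R K _ s (fun a z => \sum_(b <- s)
    a.1 * f (a.2 + z) * (b.1 * f (b.2 + z)) * psi (a.2 - b.2))).
have := ppsi [seq (p.1 * f (p.2 + z), p.2) | p <- s].
by rewrite big_map /=; under eq_bigr do rewrite big_map /=.
Qed.

Lemma autocorr_unif (e : R) : continuous f -> 0 < e ->
  \forall x \near (0 : K), forall u, `|autocorr f (u + x) - autocorr f u| <= e.
Proof.
move=> cf e0; have := unif_continuous_shift K_compact cf e0.
apply: filterS => x hx u; rewrite /autocorr -meanB; try exact: boundedM.
apply: mean_norm => y; rewrite -mulrBl normrM -[e]mulr1 ler_pM // ltW //.
by rewrite addrAC; exact: hx.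
Qed.

Lemma autocorr0_gt0 (a : K) (b : R) : 0 < b -> nbhs a [set x | b <= f x ^+ 2] ->
  0 < autocorr f 0.
Proof.
move=> b0 hb; apply: (@mean_gt0 R K K_compact _ a b) => //.
- by under eq_fun do rewrite add0r; exact: boundedM.
- by move=> x; rewrite add0r -expr2 sqr_ge0.
- by apply: filterS hb => x /=; rewrite add0r expr2.
Qed.

End Autocorr.

Definition continuous_cosine c := forall e : R, 0 < e ->
  \forall x \near (0 : K), 1 - c x < e.

(** Convolving a measure with the uniform measure on {0, x} multiplies its
    correlation with g * c by (1 + c x) / 2, up to the oscillation of g. As the
    infimum over all measures is positive, 1 - c x is small with x. *)
Lemma cosine_continuous g c (d : R) : 0 < d ->
    (forall e, 0 < e -> \forall x \near (0 : K), forall u, `|g (u + x) - g u| <= e) ->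
    normalized c -> dAlembert c -> (forall v, d <= corr v (fun x => g x * c x)) ->
  continuous_cosine c.
Proof.
move=> d0 hg nc Ac hd e e0.
pose A : set R := [set corr v (fun x => g x * c x) | v in [set: seq K]].
have Alb : lbound A d by move=> _ [v _ <-].
have infA : has_inf A by split; [exists (corr [::] (fun x => g x * c x)), [::] | exists d].
set m := inf A.
have dm : d <= m by exact: lb_le_inf infA.1 Alb.
have m0 : 0 < m by exact: lt_le_trans dm.
pose e' := e * m / 4.
have e'0 : 0 < e' by rewrite divr_gt0 // mulr_gt0.
have [_ [v _ <-] hv] := inf_adherent e'0 infA.
have hN : \forall x \near (0 : K), forall u, `|g (u - x) - g u| <= e'.
  by have := @opp_continuous K 0; rewrite /continuous_at oppr0 => /(_ _ (hg _ e'0)).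
near=> x.
have gx u : `|g (u + x) - g u| <= e' by move: u; near: x; exact: hg.
have gNx u : `|g (u - x) - g u| <= e' by move: u; near: x; exact: hN.
have [u hu] := avg_conv R v [:: x].
have mu : m <= corr u (fun x => g x * c x).
  by apply: ge_inf; [exact: infA.2 | exists u].
have two (F : K -> R) : avg [:: x] F = (F 0 + F x) / 2.
  by rewrite /avg big_cons big_seq1.
have cE y : (c (y + x) + c (y - x)) = 2 * (c y * c x) by exact: Ac.
have cb y : `|c y| <= 1 by exact: normalized_norm.
have uE (h : K -> R) : corr u h
    = corr v (fun t => (2 * h t + h (t + x) + h (t - x)) / 4).
  rewrite /corr hu; apply: avg_ext => y; rewrite two !hu mulrC -avgD -avgZ.
  apply: avg_ext => z; rewrite !two !addr0.
  have -> : y - (z + x) = y - z - x by rewrite opprD addrA.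
  have -> : y + x - (z + x) = y - z by rewrite opprD addrACA subrr addr0.
  by rewrite [y + x - z]addrAC; field.
have step : corr u (fun x => g x * c x)
    <= (1 + c x) / 2 * corr v (fun x => g x * c x) + e' / 2.
  rewrite uE -corrZ -[e' / 2](corr_cst v) -corrD; apply: corr_le => t.
  have := cE t; have := gx t; have := gNx t; have := cb (t + x); have := cb (t - x).
  have bd (a b : R) : `|b| <= 1 -> `|a| <= e' -> a * b <= e'.
    move=> b1 ae; rewrite (le_trans (ler_norm _)) // normrM -[e']mulr1.
    by rewrite ler_pM.
  move=> c1 c2 /(bd _ _ c1) g1 /(bd _ _ c2) g2 cc.
  have -> : (1 + c x) / 2 * (g t * c t) = (2 * (g t * c t)
    + g t * (2 * (c t * c x))) / 4 by field.
  by rewrite -cc; move: g1 g2; lra.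
have cx := cb x; move: cx; rewrite ler_norml => /andP[cx1 cx2].
have vm : corr v (fun x => g x * c x) <= m + e' by exact: ltW.
have : m <= (1 + c x) / 2 * (m + e') + e' / 2.
  rewrite (le_trans mu) // (le_trans step) // lerD2r ler_wpM2l //; lra.
have e'E : e' = e * m / 4 by [].
move: e'E m0 e0 cx1 cx2; clear; move: (c x) => y; move=> -> m0 e0 y1 y2 H.
rewrite -(ltr_pM2l m0); nra.
Unshelve. all: by end_near. Qed.

(** c is bounded by 1, so 2 c (na) = c ((n+1)a) + c ((n-1)a) propagates the
    extreme value. *)
Lemma normalized_mul_eq1 c a : normalized c -> dAlembert c -> c a = 1 ->
  forall n, c (a *+ n) = 1.
Proof.
move=> nc Ac ca; suff : forall n, c (a *+ n) = 1 /\ c (a *+ n.+1) = 1.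
  by move=> H n; have [] := H n.
elim=> [|n [IH1 IH2]]; first by have [_ _ c0] := nc; rewrite mulr0n mulr1n.
split=> //; have := Ac (a *+ n.+1) a.
by rewrite -mulrSr [X in X - a]mulrSr addrK IH1 IH2 ca; lra.
Qed.

(** If phi separates 0 and a, then f x = phi x - phi (x + a) has no component on
    the characters that are trivial at a, so a cosine that correlates with the
    autocorrelation of f is nontrivial there. *)
Lemma cosine_separates (a : K) : a != 0 ->
  exists c, [/\ continuous_cosine c, normalized c, dAlembert c & c a != 1].
Proof.
move=> a0.
have ns := compact_normal K_hausdorff K_compact.
have cl x : closed [set x : K].
  exact/accessible_closed_set1/hausdorff_accessible.
have : uniform_separator [set a] [set (0 : K)].
  apply: (iffLR (@normal_separatorP R K) ns) => //.
  by apply/disjoints_subset => x ->; exact/eqP.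
case/(@uniform_separatorP K R) => phi [cphi rphi phia phi0].
have {}phia : phi a = 0 by apply: phia; exists a.
have {}phi0 : phi 0 = 1 by apply: phi0; exists 0.
have phi01 x : 0 <= phi x <= 1.
  by have := rphi (phi x); rewrite /= in_itv /=; apply; exists x.
pose f x := phi x - phi (x + a).
have ca : continuous (fun x : K => x + a).
  move=> x; apply: (@continuous_comp _ _ _ (fun x => (x, a))
    (fun p : K * K => p.1 + p.2)); last exact: add_continuous.
  by apply: cvg_pair => /=; [exact: cvg_id|exact: cvg_cst].
have cf : continuous f.
  move=> x; apply: cvgB; first exact: cphi.
  by apply: (continuous_comp (ca x)); exact: cphi.
have f1 x : `|f x| <= 1.
  by rewrite ler_norml; have := phi01 x; have := phi01 (x + a); rewrite /f; lra.
have f0 : f 0 = 1 by rewrite /f add0r phi0 phia subr0.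
pose g := autocorr f.
have g0 : 0 < g 0.
  apply: (autocorr0_gt0 f1 (_ : 0 < 1 / 4)) => //; first by lra.
    apply: filterS (_ : nbhs (0 : K) [set x | `|f 0 - f x| < 1 / 2]) => [x /=|].
    by rewrite f0 ltr_norml => /andP[]; nra.
  by move/cvgrPdist_lt : (cf 0); apply; lra.
have gn := autocorr_norm f1.
pose psi0 x := (g 0)^-1 * g x.
have npsi0 : normalized psi0.
  split=> [|y|]; last by rewrite /psi0 mulVf // gt_eqF.
    apply: pos_defZ; first by rewrite invr_ge0 ltW.
    have -> : g = (fun x => autocorr f x * 1).
      by apply/funext => x; rewrite mulr1.
    apply: (pos_def_autocorr f1) => s; have -> : \sum_(a <- s) \sum_(b <- s) a.1 * b.1 * 1
        = (\sum_(a <- s) a.1) ^+ 2 :> R.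
      rewrite expr2 mulr_suml; apply: eq_bigr => p _; rewrite mulr_sumr.
      by apply: eq_bigr => q _; rewrite mulr1.
    exact: sqr_ge0.
  by rewrite /psi0 /g autocorr_even.
have [d d0 hd] : exists2 d, 0 < d & forall v, d <= corr v (fun x => g x * psi0 x).
  apply: (corr_gt0 K_compact (_ : forall x, 0 <= _) (_ : 0 < g 0 / 4)).
  - by move=> x; rewrite mulrCA mulr_ge0 ?invr_ge0 ?(ltW g0) // -expr2 sqr_ge0.
  - by rewrite divr_gt0.
  have g02 : 0 < g 0 / 2 by rewrite divr_gt0.
  have := autocorr_unif f1 cf g02; apply: filterS => x /(_ 0).
  rewrite add0r -/g ler_norml => /andP[h _] /=.
  rewrite /psi0 mulrCA [leRHS]mulrC ler_pdivlMr //.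
  have -> : g 0 / 4 * g 0 = (g 0 / 2) * (g 0 / 2) by field.
  by apply: ler_pM; try exact: (ltW g02); move: h; lra.
have [c [nc Ac hc]] := cosine_exists d0 gn (autocorr_even f1)
  (pos_def_autocorr f1) npsi0 hd.
have d20 : 0 < d / 2 by rewrite divr_gt0.
exists c; split => //.
  by apply: (cosine_continuous d20 _ nc Ac hc) => e e0; exact: autocorr_unif.
(* If c a = 1, testing against the uniform measure on 0, a, ..., na leaves the
   square norm of the average of the translates of f, which telescopes. *)
apply/eqP => ca1.
have can := normalized_mul_eq1 nc Ac ca1.
have [n hn] : exists n, n.+1%:R ^-1 < d / 2.
  exists (Num.truncn (2 / d)); rewrite -[d / 2]invrK ltf_pV2 ?posrE ?ltr0n //.
    by rewrite invf_div truncnS_gt.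
  by rewrite invr_gt0.
have := hc [seq a *+ i | i <- iota 1 n].
have sE (F : K -> R) : \sum_(x <- 0 :: [seq a *+ i | i <- iota 1 n]) F x
    = \sum_(0 <= i < n.+1) F (a *+ i).
  by rewrite -[RHS](big_map (fun i => a *+ i) xpredT).
rewrite corrE sE size_map size_iota.
under eq_bigr do rewrite sE.
have -> : \sum_(0 <= i < n.+1) \sum_(0 <= j < n.+1)
      g (a *+ i - a *+ j) * c (a *+ i - a *+ j)
    = mean (fun z => (\sum_(0 <= i < n.+1) f (a *+ i + z)) ^+ 2).
  have fM i j : bounded (fun z => f (a *+ i + z) * f (a *+ j + z)).
    by apply: boundedM; exists 1.
  have -> : (fun z => (\sum_(0 <= i < n.+1) f (a *+ i + z)) ^+ 2)
      = (fun z => \sum_(0 <= i < n.+1) \sum_(0 <= j < n.+1)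
          f (a *+ i + z) * f (a *+ j + z)).
    apply/funext => z; rewrite expr2 mulr_suml.
    by apply: eq_bigr => i _; rewrite mulr_sumr.
  rewrite (@mean_sum R K _ _ (fun i z => \sum_(0 <= j < n.+1)
          f (a *+ i + z) * f (a *+ j + z))) => [|i]; last first.
    exact: (@bounded_sum R K _ _ (fun j z => f (a *+ i + z) * f (a *+ j + z))).
  apply: eq_bigr => i _.
  rewrite (@mean_sum R K _ _ (fun j z => f (a *+ i + z) * f (a *+ j + z))) //.
  apply: eq_bigr => j _; rewrite -autocorr_sub //.
  suff -> : c (a *+ i - a *+ j) = 1 by rewrite mulr1.
  have [ij|/ltnW ij] := leqP i j; last by rewrite -mulrnBr.
  by have [_ ec _] := nc; rewrite -ec opprB -mulrnBr.
have : mean (fun z => (\sum_(0 <= i < n.+1) f (a *+ i + z)) ^+ 2) <= 1.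
  apply: (le_trans (ler_norm _)); apply: mean_norm => z.
  rewrite normrX expr_le1 //.
  have -> : \sum_(0 <= i < n.+1) f (a *+ i + z) = phi z - phi (a *+ n.+1 + z).
    transitivity (- \sum_(0 <= i < n.+1) (phi (a *+ i.+1 + z) - phi (a *+ i + z))).
      rewrite -sumrN; apply: eq_bigr => i _.
      by rewrite opprB /f addrAC -mulrSr.
    by rewrite (telescope_sumr (fun i => phi (a *+ i + z))) // mulr0n add0r opprB.
  by rewrite ler_norml; have := phi01 z; have := phi01 (a *+ n.+1 + z); lra.
move=> h1 /(lt_le_trans hn); rewrite ltNge => /negP; apply.
rewrite (@le_trans _ _ (1 / n.+1%:R ^+ 2)) ?ler_pM2r ?invr_gt0 ?exprn_gt0 ?ltr0n //.
rewrite mul1r lef_pV2 ?posrE ?exprn_gt0 ?ltr0n //.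
by rewrite -natrX ler_nat expnS leq_pmulr.
Qed.

End PeterWeyl.

(** * The dual group *)

Section Dual.
Variables (R : realType) (K : topologicalZmodType).

(** For a homomorphism, this condition at 0 is continuity: cre is near 1 only
    near 0. *)
Definition is_character : {pred K -> circle R} := [pred chi : K -> circle R | `[<
  (forall x y, chi (x + y) = chi x + chi y) /\
  forall e : R, 0 < e -> \forall x \near (0 : K), 1 - cre (chi x) < e >]].

Fact is_character_zmod_closed : zmod_closed is_character.
Proof.
split.
  apply/asboolP; split => [x y|e e0]; first by rewrite /= addr0.
  by near=> x; rewrite cre0 subrr.
move=> f g /asboolP[fD fc] /asboolP[gD gc]; apply/asboolP; split.
  move=> x y; change (f (x + y) - g (x + y) = f x - g x + (f y - g y)).
  by rewrite fD gD opprD addrACA.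
move=> e e0; have e4 : 0 < e / 4 by rewrite divr_gt0.
near=> x; rewrite (le_lt_trans (creD_defect _ _)) // creN.
have h1 : 1 - cre (f x) < e / 4 by near: x; exact: fc.
have h2 : 1 - cre (g x) < e / 4 by near: x; exact: gc.
by lra.
Unshelve. all: by end_near. Qed.

HB.instance Definition _ :=
  GRing.isZmodClosed.Build (K -> circle R) is_character is_character_zmod_closed.

Record character := Character
  { character_fun :> K -> circle R; _ : character_fun \in is_character }.

HB.instance Definition _ := [isSub for character_fun].
HB.instance Definition _ := [Choice of character by <:].
HB.instance Definition _ := [SubChoice_isSubZmodule of character by <:].

Implicit Types chi psi : character.

Lemma charD chi x y : chi (x + y) = chi x + chi y.
Proof. by case: chi => f /= /asboolP[]. Qed.

Lemma char_continuous0 chi (e : R) : 0 < e ->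
  \forall x \near (0 : K), 1 - cre (chi x) < e.
Proof. by case: chi => f /= /asboolP[_ h] e0; exact: h. Qed.

Lemma char0 chi : chi 0 = 0.
Proof. by apply: (addrI (chi 0)); rewrite -charD !addr0. Qed.

Lemma charN chi x : chi (- x) = - chi x.
Proof. by apply: (addrI (chi x)); rewrite -charD !subrr char0. Qed.

Lemma charMn chi x n : chi (x *+ n) = chi x *+ n.
Proof.
by elim: n => [|n IH]; rewrite ?mulr0n ?char0 // !mulrS charD IH.
Qed.

Lemma charDE chi psi x : (chi + psi) x = chi x + psi x. Proof. by []. Qed.
Lemma char0E x : (0 : character) x = 0. Proof. by []. Qed.
Lemma charNE chi x : (- chi) x = - chi x. Proof. by []. Qed.
Lemma char_ext chi psi : chi =1 psi -> chi = psi.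
Proof. by move=> /funext h; exact: val_inj. Qed.

Lemma cre_char_continuous chi t : continuous (fun x => cre (chi x + t)).
Proof.
move=> x; apply/cvgrPdist_lt => e e0.
have d0 : 0 < e ^+ 2 / 2 by rewrite divr_gt0 // exprn_gt0.
have := nbhs_shift x (char_continuous0 chi d0); apply: filterS => y /= hy.
have yE : chi x + t + chi (y - x) = chi y + t.
  by rewrite addrAC -charD [x + (y - x)]addrC subrK.
have := cre_lip (chi x + t) (chi (y - x)); rewrite yE => h.
have : (cre (chi y + t) - cre (chi x + t)) ^+ 2 < e ^+ 2 by move: h hy; lra.
by rewrite distrC -(real_normK (num_real (_ - _))) ltr_sqr ?nnegrE // ltW.
Qed.

Lemma closed_char_eq chi t : closed [set x | chi x = t].
Proof.
have -> : [set x | chi x = t] = (fun x => cre (chi x - t)) @^-1` [set r | 1 <= r].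
  apply/seteqP; split => x /=; first by move=> ->; rewrite subrr cre0.
  move=> h; apply/eqP; rewrite -subr_eq0; apply/eqP/cre_eq1.
  by apply/eqP; rewrite eq_le cre_le1.
apply: closed_comp; last exact: closed_ge.
by move=> x _; exact: cre_char_continuous.
Qed.

Lemma open_char_neq0 chi : open [set x | chi x != 0].
Proof.
have -> : [set x | chi x != 0] = ~` [set x | chi x = 0].
  by apply/seteqP; split => x /= /eqP.
by rewrite openC; exact: closed_char_eq.
Qed.

End Dual.

Section CosineToCharacter.
Variables (R : realType) (K : topologicalZmodType).

(** The imaginary part is recovered, up to a global sign, from
    s x * s a = (c (x - a) - c (x + a)) / 2 by fixing a point a where
    s a <> 0; if there is none, then s = 0 will do. *)
Lemma character_of_cosine (c : K -> R) : normalized c -> dAlembert c ->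
    continuous_cosine c ->
  exists chi : character R K, forall x, cre (chi x) = c x.
Proof.
move=> nc Ac cc; have [_ ec c0] := nc.
suff [s [s1 s2 s3]] : exists s : K -> R,
    [/\ forall x, c x ^+ 2 + s x ^+ 2 = 1,
        forall x y, c (x + y) = c x * c y - s x * s y &
        forall x y, s (x + y) = s x * c y + c x * s y].
  pose f x := mk_circle (s1 x).
  have fP : f \in @is_character R K.
    apply/asboolP; split => [x y|]; last exact: cc.
    by apply: circle_ext; [exact: s2 | exact: s3].
  by exists (Character fP).
have [[a ha]|H] := pselect (exists a, c a ^+ 2 != 1); last first.
  have {}H x : c x ^+ 2 = 1.
    by apply/eqP/negPn/negP => h; apply: H; exists x.
  exists (fun=> 0); split=> [x|x y|x y]; rewrite ?mulr0 ?mul0r ?addr0 //.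
    by rewrite expr0n addr0.
  have := Ac x y; have := H x; have := H y; have := H (x + y); have := H (x - y).
  rewrite subr0; move: (c _) (c _) (c _) (c _) => p q r t.
  move=> /eqP; rewrite sqrf_eq1 => /orP[] /eqP-> /eqP; rewrite sqrf_eq1 =>
    /orP[] /eqP-> /eqP; rewrite sqrf_eq1 => /orP[] /eqP-> /eqP; rewrite
    sqrf_eq1 => /orP[] /eqP->; lra.
pose A x y := c x * c y - c (x + y).
have ca1 : 0 < 1 - c a ^+ 2.
  rewrite subr_gt0 lt_neqAle ha /= -(real_normK (num_real _)) expr_le1 //.
  exact: normalized_norm.
have AE x y : A x y = (c (x - y) - c (x + y)) / 2.
  by have := Ac x y; rewrite /A; lra.
have Aaa : A a a = 1 - c a ^+ 2.
  by have := Ac a a; rewrite subrr c0 /A; lra.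
pose r := Num.sqrt (1 - c a ^+ 2).
have r0 : 0 < r by rewrite sqrtr_gt0.
have r2 : r ^+ 2 = 1 - c a ^+ 2 by rewrite sqr_sqrtr // ltW.
have prod x y : A x a * A y a = A x y * A a a.
  have P1 := Ac (x - a) (y - a); have P2 := Ac (x - a) (y + a).
  have P3 := Ac (x + a) (y - a); have P4 := Ac (x + a) (y + a).
  have Q1 := Ac (x + y) (a + a); have Q2 := Ac (x - y) (a + a).
  have Aaa2 : A a a = (1 - c (a + a)) / 2 by rewrite AE subrr c0.
  rewrite Aaa2 !AE.
  have e1 : x - a + (y - a) = x + y - (a + a) by rewrite addrACA -opprD.
  have e2 : x - a - (y - a) = x - y by rewrite opprB addrA subrK.
  have e3 : x - a + (y + a) = x + y by rewrite addrACA addNr addr0.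
  have e4 : x - a - (y + a) = x - y - (a + a) by rewrite !opprD addrACA.
  have e5 : x + a + (y - a) = x + y by rewrite addrACA subrr addr0.
  have e6 : x + a - (y - a) = x - y + (a + a) by rewrite opprB addrACA [RHS]addrAC
    -!addrA; congr (_ + _); rewrite addrCA [a + (- y + a)]addrCA.
  have e7 : x + a + (y + a) = x + y + (a + a) by rewrite addrACA.
  have e8 : x + a - (y + a) = x - y by rewrite opprD addrACA subrr addr0.
  rewrite e1 e2 in P1; rewrite e3 e4 in P2; rewrite e5 e6 in P3; rewrite e7 e8 in P4.
  by lra.
have add x y : A (x + y) a = A x a * c y + c x * A y a.
  have P1 := Ac (x + a) y; have P2 := Ac x (y + a).
  have P3 := Ac (x - y) a; have P4 := Ac x y.
  rewrite /A.
  have e1 : x + a + y = x + y + a by rewrite addrAC.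
  have e2 : x + a - y = x - y + a by rewrite addrAC.
  have e3 : x + (y + a) = x + y + a by rewrite addrA.
  have e4 : x - (y + a) = x - y - a by rewrite opprD addrA.
  rewrite e1 e2 in P1; rewrite e3 e4 in P2.
  have -> : c (x + y) = 2 * (c x * c y) - c (x - y) by lra.
  by lra.
exists (fun x => A x a / r).
have key x y : A x a / r * (A y a / r) = A x y.
  rewrite mulrACA prod Aaa -r2; field; exact: lt0r_neq0.
split=> [x|x y|x y].
- rewrite [X in _ + X]expr2 key /A; have := Ac x x; rewrite subrr c0; lra.
- by rewrite key /A; lra.
- by rewrite add mulrDl; congr (_ + _); ring.
Qed.

End CosineToCharacter.

Section Separation.
Variables (R : realType) (K : topologicalZmodType).
Hypothesis K_hausdorff : hausdorff_space K.
Hypothesis K_compact : compact [set: K].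

(** The Peter-Weyl theorem for compact abelian groups, or the injective half of
    Pontryagin duality. *)
Theorem characters_separate (a : K) : a != 0 ->
  exists chi : character R K, chi a != 0.
Proof.
move=> /(cosine_separates R K_hausdorff K_compact)[c [cc nc Ac ca]].
have [chi hchi] := character_of_cosine nc Ac cc.
exists chi; apply: contra ca => /eqP h.
by rewrite -hchi h cre0.
Qed.

(** Compactness turns separation of points into a description of the topology:
    finitely many characters suffice around each point. *)
Lemma nbhs_characters (a : K) (U : set K) : nbhs a U ->
  exists s : seq (character R K),
    forall x, (forall chi, chi \in s -> chi x = chi a) -> U x.
Proof.
rewrite nbhsE => -[V [oV Va VU]].
have cV : compact (~` V).
  by apply: (subclosed_compact _ K_compact) => //; exact: open_closedC.
have [|s hs] := compact_seq_cover
    (O := fun chi : character R K => [set x | chi (x - a) != 0]) cV.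
  move=> x Vx; have xa : x - a != 0.
    by rewrite subr_eq0; apply/eqP => e; apply: Vx; rewrite e.
  have [chi hchi] := characters_separate xa.
  exists chi; have h : nbhs (x - a) [set y | chi y != 0].
    by apply: open_nbhs_nbhs; split => //; exact: open_char_neq0.
  have := nbhs_shift x (nbhs_translate h); apply: filterS => y /=.
  by rewrite (_ : x - a + (y - x) = y - a) // addrC addrA subrK.
exists s => x hx; apply: VU; apply: contrapT => Vx.
have [chi schi /=] := hs x Vx.
by rewrite charD charN hx // subrr eqxx.
Qed.

End Separation.

Section Shuffle.
Variable M : zmodType.
Implicit Types a b t s u v : M.

Fact sub_shuffle a b t s : a - b + (t - s) = a + t - (b + s).
Proof. by rewrite opprD addrACA. Qed.

Fact add_shuffle3 a b t s u v :
  a + b - (u + v) + (t + s) = a - u + t + (b - v + s).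
Proof. by rewrite opprD (addrACA a b) (addrACA (a - u)). Qed.

Fact sub_shuffle3 a b t s u v :
  a - b - (u - v) + (t - s) = a - u + t - (b - v + s).
Proof. by rewrite add_shuffle3 !opprD. Qed.

End Shuffle.

Section Evaluation.
Variables (R : realType) (K : topologicalZmodType).
Hypothesis K_compact : compact [set: K].

(** The mean m t is invariant under t |-> t + chi a, while
    m (t + chi a) + m (t - chi a) = 2 cre (chi a) m t. *)
Lemma mean_character (chi : character R K) t : chi != 0 ->
  mean (fun x => cre (chi x + t)) = 0.
Proof.
move=> chi0.
have [a ha] : exists a, chi a != 0.
  apply: contrapT => h; move/eqP: chi0; apply; apply: char_ext => x.
  by apply/eqP/negPn/negP => hx; apply: h; exists x.
have hb s : bounded (fun x : K => cre (chi x + s)).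
  by exists 1 => x; exact: cre_norm.
pose m s := mean (fun x => cre (chi x + s)).
have shift s : m (s + chi a) = m s.
  rewrite /m -[RHS](mean_shift a) //; congr mean; apply/funext => x.
  by rewrite charD addrAC addrA.
have : m (t + chi a) + m (t - chi a) = 2 * cre (chi a) * m t.
  rewrite /m -meanZ // -meanD //; congr mean; apply/funext => x.
  rewrite (addrA (chi x) t (chi a)) (addrA (chi x) t (- chi a)).
  by have := creM (chi x + t) (chi a); lra.
have -> : m (t - chi a) = m t by rewrite -(shift (t - chi a)) subrK.
rewrite shift => H; have ca : cre (chi a) != 1.
  by apply: contra ha => /eqP /cre_eq1 ->.
have : (cre (chi a) - 1) * m t = 0 by lra.
by move=> /eqP; rewrite mulf_eq0 subr_eq0 (negPf ca) /= => /eqP.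
Qed.

Variable f : character R K -> circle R.
Hypothesis fD : forall chi psi, f (chi + psi) = f chi + f psi.

Let f0 : f 0 = 0.
Proof. by apply: (addrI (f 0)); rewrite -fD !addr0. Qed.

Let fN chi : f (- chi) = - f chi.
Proof. by apply: (addrI (f chi)); rewrite -fD !subrr f0. Qed.

(** [twin p q] means that the trigonometric polynomial q is obtained from p by
    twisting each character chi by - f chi, as a translation by a point
    evaluating to f would do. *)
Inductive twin : (K -> R) -> (K -> R) -> Prop :=
| TwinCos (chi : character R K) t : twin (fun x => cre (chi x + t)) (fun x => cre (chi x - f chi + t))
| TwinAdd p q p' q' : twin p q -> twin p' q' ->
    twin (fun x => p x + p' x) (fun x => q x + q' x)
| TwinScale a p q : twin p q -> twin (fun x => a * p x) (fun x => a * q x).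

Lemma twin_bounded p q : twin p q -> bounded p /\ bounded q.
Proof.
elim=> {p q} [chi t|p q p' q' _ [? ?] _ [? ?]|a p q _ [? ?]].
- by split; exists 1 => x; exact: cre_norm.
- by split; exact: boundedD.
- by split; exact: boundedZ.
Qed.

Lemma twin_mean p q : twin p q -> mean p = mean q.
Proof.
elim=> {p q} [chi t|p q p' q' /twin_bounded[? ?] IH /twin_bounded[? ?] IH'|
              a p q /twin_bounded[? ?] IH].
- have [->|chi0] := eqVneq chi 0.
    by congr mean; apply/funext => x; rewrite f0 char0E subrr add0r.
  under [in RHS]eq_fun do rewrite -addrA.
  by rewrite !mean_character.
- by rewrite !meanD // IH IH'.
- by rewrite !meanZ // IH.
Qed.

Lemma twin1 : twin (fun=> 1) (fun=> 1).
Proof.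
have := TwinCos 0 0; congr (twin _ _); apply/funext => x.
  by rewrite char0E addr0 cre0.
by rewrite char0E f0 subrr addr0 cre0.
Qed.

(** The product of two cosines is half the sum of those of the sum and of the
    difference, and twisting is compatible with sums of characters. *)
Lemma twinM p q p' q' : twin p q -> twin p' q' ->
  twin (fun x => p x * p' x) (fun x => q x * q' x).
Proof.
move=> h h'; elim: h => {p q} [chi t|p1 q1 p2 q2 _ IH1 _ IH2|a p q _ IH].
- elim: h' => {p' q'} [psi s|p1 q1 p2 q2 _ IH1 _ IH2|a p q _ IH].
  + have := TwinScale 2^-1 (TwinAdd (TwinCos (chi + psi) (t + s))
                                    (TwinCos (chi - psi) (t - s))).
    congr (twin _ _); apply/funext => x; rewrite charDE charDE charNE.
      rewrite (addrACA (chi x)) (sub_shuffle (chi x)).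
      by have := creM (chi x + t) (psi x + s); lra.
    rewrite !fD fN (add_shuffle3 (chi x)) (sub_shuffle3 (chi x)).
    by have := creM (chi x - f chi + t) (psi x - f psi + s); lra.
  + have := TwinAdd IH1 IH2; congr (twin _ _); apply/funext => x;
      by rewrite mulrDr.
  + have := TwinScale a IH; congr (twin _ _); apply/funext => x;
      by rewrite mulrCA.
- have := TwinAdd IH1 IH2; congr (twin _ _); apply/funext => x;
    by rewrite mulrDl.
- have := TwinScale a IH; congr (twin _ _); apply/funext => x;
    by rewrite mulrA.
Qed.

Lemma twinX n p q : twin p q -> twin (fun x => p x ^+ n) (fun x => q x ^+ n).
Proof.
move=> h; elim: n => [|n IH]; first exact: twin1.
have := twinM h IH; congr (twin _ _); apply/funext => x; by rewrite exprS.
Qed.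

(** This reaches its maximum 1 exactly where chi x = u chi for chi in s. *)
Let bump (u : character R K -> circle R) (s : seq (character R K)) : K -> R :=
  fun x => \prod_(chi <- s) ((1 + cre (chi x - u chi)) / 2).

Let factor01 u (chi : character R K) x : 0 <= (1 + cre (chi x - u chi)) / 2 <= 1.
Proof. by have := cre_norm (chi x - u chi); rewrite ler_norml; lra. Qed.

Let bump01 u s x : 0 <= bump u s x <= 1.
Proof.
rewrite /bump; elim: s => [|chi s /andP[IH0 IH1]].
  by rewrite big_nil ler01 lexx.
rewrite big_cons; have /andP[h0 h1] := factor01 u chi x.
by rewrite mulr_ge0 //= -[1 as X in _ <= X]mulr1 ler_pM.
Qed.

Let bump_continuous u s : continuous (bump u s).
Proof.
rewrite /bump; elim: s => [|chi s IH] x.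
  by under eq_fun do rewrite big_nil; exact: cvg_cst.
under eq_fun do rewrite big_cons; apply: cvgM; last exact: IH.
apply: cvgM; last exact: cvg_cst.
by apply: cvgD; [exact: cvg_cst | exact: cre_char_continuous].
Qed.

Let bump_twin s : twin (bump (fun=> 0) s) (bump f s).
Proof.
rewrite /bump; elim: s => [|chi s IH].
  by under eq_fun do rewrite big_nil; under [X in twin _ X]eq_fun do rewrite big_nil;
    exact: twin1.
have := twinM (TwinScale 2^-1 (TwinAdd twin1 (TwinCos chi 0))) IH.
by congr (twin _ _); apply/funext => x; rewrite big_cons !addr0 ?subr0 mulrC;
  rewrite [_^-1 * _]mulrC mulrC.
Qed.

Let bump_lt1 s x (chi : character R K) : chi \in s -> chi x != f chi -> bump f s x < 1.
Proof.
move=> cs h; rewrite /bump (big_rem chi) //=.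
have /andP[r0 r1] := bump01 f (rem chi s) x.
have /andP[h0 _] := factor01 f chi x.
have h1 : (1 + cre (chi x - f chi)) / 2 < 1.
  suff : cre (chi x - f chi) < 1 by lra.
  rewrite lt_neqAle cre_le1 andbT; apply: contra h => /eqP/cre_eq1/eqP.
  by rewrite subr_eq0.
by rewrite (le_lt_trans _ h1) // -[leRHS]mulr1 ler_wpM2l.
Qed.

(** If no point evaluated to f on s, the twisted bump would be at most r < 1
    everywhere. The untwisted one is close to 1 on a neighborhood of 0, so its
    large powers have a larger mean; but twins have the same mean. *)
Let evaluation_finite (s : seq (character R K)) :
  exists x : K, forall chi, chi \in s -> chi x = f chi.
Proof.
apply: contrapT => hs.
have lt1 x : bump f s x < 1.
  have [chi cs hc] : exists2 chi, chi \in s & chi x != f chi.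
    apply: contrapT => h; apply: hs; exists x => chi cs.
    by apply/eqP/negPn/negP => hc; apply: h; exists chi.
  exact: bump_lt1 cs hc.
have K0 : [set: K] !=set0 by exists 0.
have [|x0 _ hx0] := compact_EVT_max (f := bump f s) K0 K_compact.
  by apply: continuous_subspaceT; exact: bump_continuous.
set r := bump f s x0 in hx0.
have r1 : r < 1 := lt1 x0.
have r0 : 0 <= r by have /andP[] := bump01 f s x0.
pose r' := (1 + r) / 2.
have r'0 : 0 < r' by rewrite /r'; lra.
have r'1 : r' < 1 by rewrite /r'; lra.
have rr' : r < r' by rewrite /r'; lra.
pose p := bump (fun=> 0) s.
have p0 : p 0 = 1.
  by rewrite /p /bump big1 // => chi _; rewrite char0 subrr cre0; field.
pose h x : R := (`[< r' <= p x >] : nat)%:R.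
have h01 x : 0 <= h x <= 1 by rewrite /h; case: asboolP; rewrite ?lexx ler01.
have hb : bounded h.
  by exists 1 => x; have /andP[h0 h1] := h01 x; rewrite ger0_norm.
have mh : 0 < mean h.
  apply: (@mean_gt0 R K K_compact h 0 1) => //.
  have d0 : 0 < 1 - r' by lra.
  have /cvgrPdist_lt /(_ _ d0) := @bump_continuous (fun=> 0) s 0.
  apply: filterS => x; rewrite -/(p 0) -/(p x) p0 ltr_norml => /andP[_ hx] /=.
  by rewrite /h asboolT //; lra.
have t0 : 0 <= r / r' by rewrite divr_ge0 // ltW.
have t1 : `|r / r'| < 1 by rewrite (ger0_norm t0) ltr_pdivrMr // mul1r.
have /cvgrPdist_lt /(_ _ mh) [N _ /(_ N (leqnn _))] := cvg_expr t1.
rewrite /= sub0r normrN ger0_norm; last by rewrite exprn_ge0.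
rewrite expr_div_n ltr_pdivrMr ?exprn_gt0 // => HN.
have pb : bounded (fun x => p x ^+ N).
  by have [] := twin_bounded (twinX N (bump_twin s)).
have qb : bounded (fun x => bump f s x ^+ N).
  by have [] := twin_bounded (twinX N (bump_twin s)).
have le1 : r' ^+ N * mean h <= mean (fun x => p x ^+ N).
  rewrite -meanZ //; apply: mean_le => // [|x]; first exact: boundedZ.
  rewrite /h; case: asboolP => hx; last first.
    by rewrite mulr0 exprn_ge0 //; have /andP[] := bump01 (fun=> 0) s x.
  by rewrite mulr1 lerXn2r // nnegrE ltW // (lt_le_trans r'0).
have le2 : mean (fun x => bump f s x ^+ N) <= r ^+ N.
  rewrite -[leRHS](@mean_cst R K); apply: mean_le => // [|x].
    exact: bounded_cst.
  rewrite lerXn2r ?nnegrE //; first by have /andP[] := bump01 f s x.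
  by apply: hx0; rewrite inE.
have := twin_mean (twinX N (bump_twin s)); rewrite -/p => E.
move: le1; rewrite E => /le_trans /(_ le2).
by rewrite leNgt mulrC HN.
Qed.

(** The surjective half of Pontryagin duality: by compactness, the case of
    finitely many characters suffices. *)
Theorem evaluation_surjective : exists x : K, forall chi : character R K, chi x = f chi.
Proof.
apply: contrapT => hx.
have [|s hs] := compact_seq_cover
    (O := fun chi : character R K => [set x | chi x != f chi]) K_compact.
  move=> x _; have [chi hchi] : exists chi : character R K, chi x != f chi.
    apply: contrapT => h; apply: hx; exists x => chi.
    by apply/eqP/negPn/negP => hc; apply: h; exists chi.
  exists chi; apply: open_nbhs_nbhs; split => //.
  have -> : [set x | chi x != f chi] = ~` [set x | chi x = f chi].
    by apply/seteqP; split => y /= /eqP.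
  by rewrite openC; exact: closed_char_eq.
have [x hsx] := evaluation_finite s.
by have [chi cs /=] := hs x I; rewrite hsx // eqxx.
Qed.

End Evaluation.

(** * Subgroups and partial homomorphisms *)

Lemma countable_sub (T : Type) (A B : set T) :
  A `<=` B -> countable B -> countable A.
Proof. by move=> AB; apply: sub_countable; exact: subset_card_le. Qed.

Lemma countable_image (T U : Type) (f : T -> U) (A : set T) :
  countable A -> countable (f @` A).
Proof. by apply: sub_countable; exact: card_image_le. Qed.

Lemma countableU (T : Type) (A B : set T) :
  countable A -> countable B -> countable (A `|` B).
Proof.
move=> cA cB.
apply: (@countable_sub _ _ (\bigcup_(b in [set: bool]) if b then A else B)).
  by move=> x [Ax|Bx]; [exists true|exists false].
by apply: bigcup_countable => // -[].
Qed.

Section Span.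
Variable M : zmodType.
Implicit Types (S T : set M) (x y : M).

Inductive span S : set M :=
| span_in x : S x -> span S x
| span0 : span S 0
| spanB x y : span S x -> span S y -> span S (x - y).

Lemma spanN S x : span S x -> span S (- x).
Proof. by move=> h; rewrite -sub0r; apply: spanB => //; exact: span0. Qed.

Lemma spanD S x y : span S x -> span S y -> span S (x + y).
Proof. by move=> hx hy; rewrite -[y]opprK; apply: spanB => //; exact: spanN. Qed.

Lemma spanMn S x n : span S x -> span S (x *+ n).
Proof.
move=> h; elim: n => [|n IH]; first by rewrite mulr0n; exact: span0.
by rewrite mulrS; exact: spanD.
Qed.

Lemma spanMz S x k : span S x -> span S (x *~ k).
Proof.
move=> h; case: k => n; first by rewrite -pmulrn; exact: spanMn.
by rewrite NegzE mulrNz -pmulrn; apply: spanN; exact: spanMn.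
Qed.

Lemma span_sub S T : S `<=` span T -> span S `<=` span T.
Proof.
move=> ST x; elim=> {x} [x /ST //||x y _ hx _ hy]; first exact: span0.
exact: spanB.
Qed.

Lemma span_mono S T : S `<=` T -> span S `<=` span T.
Proof. by move=> ST; apply: span_sub => x /ST; exact: span_in. Qed.

(** Membership in a generated subgroup has finite character; the first term of
    the union accounts for the empty chain. *)
Lemma span_bigcup (F : set (set M)) S : total_on F subset ->
  span (\bigcup_(X in F) X `|` S) `<=`
  span S `|` \bigcup_(X in F) span (X `|` S).
Proof.
move=> tF x; elim=> {x} [x [[X FX Xx]|Sx]||x y _ hx _ hy].
- by right; exists X => //; apply: span_in; left.
- by left; exact: span_in.
- by left; exact: span0.
- have up X : span S `<=` span (X `|` S) by apply: span_mono => z; right.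
  case: hx => [hx|[X FX hx]]; case: hy => [hy|[Y FY hy]].
  + by left; exact: spanB.
  + by right; exists Y => //; apply: spanB => //; exact: up.
  + by right; exists X => //; apply: spanB => //; exact: up.
  + have [XY|YX] := tF _ _ FX FY.
      right; exists Y => //; apply: spanB => //; apply: span_mono hx => z [/XY|];
        by [left|right].
    right; exists X => //; apply: spanB => //; apply: span_mono hy => z [/YX|];
      by [left|right].
Qed.

Lemma span_setU1 S m x : span ([set m] `|` S) x ->
  exists s k, span S s /\ x = s + m *~ k.
Proof.
elim=> {x} [x [->|Sx]||x y _ [s [k [hs ->]]] _ [t [l [ht ->]]]].
- by exists 0, 1; split; [exact: span0 | rewrite add0r mulr1z].
- by exists x, 0; split; [exact: span_in | rewrite mulr0z addr0].
- by exists 0, 0; split; [exact: span0 | rewrite mulr0z addr0].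
- exists (s - t), (k - l); split; first exact: spanB.
  by rewrite mulrzBr opprD addrACA.
Qed.

Lemma countable_span S : countable S -> countable (span S).
Proof.
move=> cS.
pose L := fix L n : set M := if n is n'.+1
  then (fun p : M * M => p.1 - p.2) @` (L n' `*` L n') else S `|` [set 0].
have cL n : countable (L n).
  elim: n => [|n IH] /=; first by exact: countableU.
  by apply: countable_image; exact: countableX.
have L0 n : L n 0.
  elim: n => [|n IH] /=; first by right.
  by exists (0, 0) => //=; rewrite subrr.
have Lm n x : L n x -> L n.+1 x.
  by move=> h; exists (x, 0) => //=; rewrite subr0.
have Lle m n x : (m <= n)%N -> L m x -> L n x.
  move=> /subnK <-; elim: (n - m)%N => [//|k IH] h; rewrite addSn.
  by apply: Lm; exact: IH.
apply: (@countable_sub _ _ (\bigcup_n L n)); last exact: bigcup_countable.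
move=> x; elim=> {x} [x Sx||x y _ [m _ hx] _ [n _ hy]].
- by exists 0 => //; left.
- by exists 0.
- exists (maxn m n).+1 => //=; exists (x, y) => //; split => /=.
    exact: Lle (leq_maxl _ _) hx.
  exact: Lle (leq_maxr _ _) hy.
Qed.

End Span.

Section Functional.
Variables (X Y : zmodType).
Implicit Types (S V : set (X * Y)) (m : X * Y).

(** A subgroup of X * Y is the graph of a partial homomorphism if and only if
    it contains no element (0, h) with h <> 0. *)
Definition functional S := forall h, span S (0, h) -> h = 0.

Definition dom S : set X := [set x | exists h, span S (x, h)].

Lemma functional_uniq S x h h' : functional S ->
  span S (x, h) -> span S (x, h') -> h = h'.
Proof.
move=> fS hx hx'; apply/eqP; rewrite -subr_eq0; apply/eqP/fS.
by have := spanB hx hx'; rewrite /= -[(x, h) - (x, h')]/(x - x, h - h') subrr.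
Qed.

Lemma dom_span S : span (dom S) `<=` dom S.
Proof.
move=> x; elim=> {x} [//||x y _ [h hx] _ [h' hy]]; first by exists 0; exact: span0.
by exists (h - h'); exact: (spanB hx hy).
Qed.

(** Zorn's lemma for partial homomorphisms that extend a given one by means of
    pairs taken from V. *)
Lemma max_functional S0 V : functional S0 -> exists S,
  [/\ S `<=` V, functional (S `|` S0) &
      forall m, V m -> functional ([set m] `|` (S `|` S0)) -> S m].
Proof.
move=> fS0.
have [F FP tF|S [[SV fS] maxS]] :=
    @Zorn_bigcup _ [set S | S `<=` V /\ functional (S `|` S0)].
  split; first by move=> m [S FS Sm]; have [SV _] := FP _ FS; exact: SV.
  move=> h hh; have [h0|[S FS hS]] := span_bigcup tF hh; first exact: fS0.
  by have [_ fS] := FP _ FS; exact: fS.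
exists S; split => // m Vm fm; apply: contrapT => Sm.
apply: (maxS ([set m] `|` S)); last first.
  by split; [move=> x [->|/SV] | rewrite -setUA].
split; first by move=> x; right.
by move=> /(_ m (or_introl erefl)).
Qed.

End Functional.

Section Multiples.
Variables (X M : zmodType).

Lemma pair_mulrz (m : X * M) k : m *~ k = (m.1 *~ k, m.2 *~ k).
Proof.
have nat_case n : m *+ n = (m.1 *+ n, m.2 *+ n).
  by elim: n => [//|n IH]; rewrite !mulrS IH; case: (m) => a b.
case: k => n; first by rewrite -!pmulrn.
by rewrite NegzE !mulrNz -!pmulrn nat_case.
Qed.

Lemma fct_mulrz (T : Type) (h : T -> M) k t : (h *~ k) t = h t *~ k.
Proof.
have nat_case n : (h *+ n) t = h t *+ n.
  elim: n => [//|n IH]; rewrite !mulrS -IH //.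
case: k => n; first by rewrite -!pmulrn.
rewrite NegzE !mulrNz -!pmulrn -nat_case //.
Qed.

End Multiples.

Section Prufer.
Variables (R : realType) (p : nat).
Hypothesis p_pr : prime p.
Implicit Type t : circle R.

Definition prufer t := exists n (k : int), t = troot R p n *~ k.

Lemma prufer_troot n : prufer (troot R p n).
Proof. by exists n, 1; rewrite mulr1z. Qed.

Lemma prufer0 : prufer 0.
Proof. by exists 0%N, 0; rewrite mulr0z. Qed.

Lemma troot_expz m n (k : int) :
  troot R p (m + n) *~ ((p ^ m)%N%:Z * k) = troot R p n *~ k.
Proof. by rewrite mulrzA -pmulrn troot_exp. Qed.

Lemma troot_eq0z n (k : int) : (troot R p n *~ k == 0) = ((p ^ n)%N%:Z %| k)%Z.
Proof.
have E (m : nat) : (troot R p n *~ m == 0) = ((p ^ n)%N%:Z %| m%:Z)%Z.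
  by rewrite -pmulrn troot_eq0 // dvdzE.
case: k => m; first exact: E.
by rewrite NegzE mulrNz oppr_eq0 E !dvdzE abszN.
Qed.

Lemma pruferB t u : prufer t -> prufer u -> prufer (t - u).
Proof.
move=> [n [k ->]] [m [l ->]].
exists (m + n)%N, ((p ^ m)%N%:Z * k - (p ^ n)%N%:Z * l).
by rewrite mulrzBr troot_expz addnC troot_expz.
Qed.

Lemma prufer_torsion t : prufer t -> t *+ p = 0 -> exists k, t = troot R p 1 *~ k.
Proof.
move=> [n [k ->]]; case: n => [_|n].
  by exists 0; rewrite troot0 mul0rz mulr0z.
rewrite pmulrn -mulrzA => /eqP; rewrite troot_eq0z expnSr PoszM.
rewrite dvdz_mul2r; last by rewrite -lt0n prime_gt0.
by move=> /dvdzP[l ->]; exists l; rewrite mulrC -addn1 troot_expz.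
Qed.

(** Division by the p-part of m raises the level; by the prime-to-p part, it
    is multiplication by an inverse modulo a power of p. *)
Lemma prufer_div t m : prufer t -> (0 < m)%N ->
  exists u, [/\ prufer u, u *+ m = t & t = 0 -> u = 0].
Proof.
move=> [n [k tE]] m0; have [->|t0] := eqVneq t 0.
  by exists 0; split; [exact: prufer0 | rewrite mul0rn |].
have [m' cop mE] := pfactor_coprime p_pr m0; set i := logn p m in mE.
have : coprimez m' (p ^ n)%N%:Z by rewrite coprimezE /= coprime_sym coprimeXl.
case/coprimezP => -[u v] /= uv.
exists (troot R p (i + n) *~ (k * u)); split=> [||tz]; last by rewrite tz eqxx in t0.
  by exists (i + n)%N, (k * u).
rewrite pmulrn -mulrzA mE PoszM mulrCA mulrA mulrC troot_expz tE.
apply/eqP; rewrite -subr_eq0 -mulrzBr troot_eq0z.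
apply/dvdzP; exists (- (k * v)).
have -> : m'%:Z * (k * u) = k * (u * m'%:Z) by rewrite mulrCA [m'%:Z * u]mulrC.
have -> : u * m'%:Z = 1 - v * (p ^ n)%N%:Z by rewrite -uv addrK.
by ring.
Qed.

End Prufer.

Section Independence.
Variables (R : realType) (X : zmodType) (p : nat).
Hypothesis p_pr : prime p.
Local Notation Y := (X -> circle R).
Local Notation t1 := (troot R p 1).
Implicit Types (B C I : set X) (b x : X).

Definition delta b (t : circle R) : Y := fun j => if j == b then t else 0.

Lemma delta_mulrz b t k : delta b t *~ k = delta b (t *~ k).
Proof.
by apply/funext => j; rewrite fct_mulrz /delta; case: eqP => // _; rewrite mul0rz.
Qed.

Definition graph0 C : set (X * Y) := [set m | C m.1 /\ m.2 = 0].
Definition point b : X * Y := (b, delta b t1).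

(** B is independent modulo C and modulo p in the subgroup that it generates:
    mapping each b in B to the b-th copy of the element t1 of order p, and C to
    0, is well defined. *)
Definition independent C B := functional (point @` B `|` graph0 C).

Lemma span_graph0 C : span C `<=` C -> span (graph0 C) `<=` graph0 C.
Proof.
move=> sC m; elim=> {m} [//||[x g] [y h] _ [/= Cx ->] _ [/= Cy ->]].
  by split => //; apply: sC; exact: span0.
split; first by apply: sC; apply: spanB; exact: span_in.
exact: subrr.
Qed.

Lemma max_independent C : span C `<=` C ->
  exists B, independent C B /\
    forall x, independent C ([set x] `|` B) -> B x.
Proof.
move=> sC.
have f0 : functional (graph0 C) by move=> h /(span_graph0 sC) [].
have [S [SV fS maxS]] := max_functional (range point) f0.
pose B := [set b | S (point b)].
have SE : point @` B = S.
  apply/seteqP; split=> [_ [b Bb <-] //|m Sm].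
  by have [b _ bm] := SV _ Sm; exists b => //; rewrite /B /= bm.
exists B; split; first by rewrite /independent SE.
move=> x; rewrite /independent image_setU image_set1 SE -setUA => h.
by apply: maxS => //; exists x.
Qed.

Definition dom_ind C B := dom (point @` B `|` graph0 C).

Lemma dom_ind_C C B : C `<=` dom_ind C B.
Proof. by move=> c Cc; exists 0; apply: span_in; right. Qed.

Lemma independentU1 C B x : span C `<=` C -> independent C B ->
  (forall k : int, dom_ind C B (x *~ k) -> (p%:Z %| k)%Z /\ C (x *~ k)) ->
  independent C ([set x] `|` B).
Proof.
move=> sC iB hx h; rewrite image_setU image_set1 -setUA => /span_setU1.
move=> [[u g] [k [hs]]]; rewrite pair_mulrz delta_mulrz /= => -[/esym e1 e2].
have xk : x *~ k = - u by apply/eqP; rewrite -addr_eq0 addrC e1.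
have [pk Cxk] : (p%:Z %| k)%Z /\ C (x *~ k).
  by apply: hx; exists (- g); rewrite xk; exact: (spanN hs).
have g0 : g = 0.
  apply: iB; have : span (point @` B `|` graph0 C) (x *~ k, 0).
    by apply: span_in; right.
  by move=> /(spanD hs); rewrite /= -[(u, g) + _]/(u + x *~ k, g + 0) addr0 xk subrr.
rewrite e2 g0 add0r; apply/funext => j; rewrite /delta; case: eqP => // _.
by apply/eqP; rewrite troot_eq0z // expn1.
Qed.

(** If x *~ k is in the domain, then p divides k: otherwise, as x *+ p is in C,
    Bezout's identity would put x in the domain. *)
Lemma independentU1_torsion C B x : span C `<=` C -> independent C B ->
  C (x *+ p) -> ~ dom_ind C B x -> independent C ([set x] `|` B).
Proof.
move=> sC iB Cpx nx; apply: independentU1 => // k hk.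
suff pk : (p%:Z %| k)%Z.
  split => //; case/dvdzP: pk => q ->.
  by rewrite mulrC mulrzA -pmulrn; apply: sC; apply: spanMz; exact: span_in.
apply/negPn/negP => npk; apply: nx.
have : coprimez k p%:Z.
  by rewrite coprimezE /= coprime_sym prime_coprime // -dvdzE.
case/coprimezP => -[u v] /= uv.
have -> : x = (x *~ k) *~ u + (x *+ p) *~ v.
  by rewrite pmulrn -!mulrzA -mulrzDr [k * u]mulrC [_ * v]mulrC uv mulr1z.
apply: dom_span; apply: spanD; apply: spanMz; apply: span_in => //.
exact: dom_ind_C.
Qed.

(** Here the only multiple of x in the domain is 0. *)
Lemma independentU1_free C B x : span C `<=` C -> independent C B ->
  (forall n, (0 < n)%N -> ~ dom_ind C B (x *+ n)) ->
  independent C ([set x] `|` B).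
Proof.
move=> sC iB nx; apply: independentU1 => // k hk.
have -> : k = 0.
  have H (n : nat) : dom_ind C B (x *~ n) -> n = 0%N.
    by case: n => // n h; case: (nx n.+1); rewrite // pmulrn.
  case: k hk => n; first by move=> /H ->.
  rewrite NegzE mulrNz => h.
  have := dom_span (spanN (span_in h)); rewrite opprK => /H //.
by rewrite dvdz0 mulr0z; split => //; apply: sC; exact: span0.
Qed.

Lemma countable_dom C B : countable C -> countable B -> countable (dom_ind C B).
Proof.
move=> cC cB; apply: (@countable_sub _ _ (span (B `|` C))); last first.
  by apply: countable_span; exact: countableU.
move=> x [h]; have -> : x = (x, h).1 by [].
move: (x, h) => m {x h}; elim=> {m} [m [[b Bb <-]|[Cm _]]||m n _ hm _ hn].
- by apply: span_in; left.
- by apply: span_in; right.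
- exact: span0.
- exact: spanB.
Qed.

(** The direct sum of copies of the Pruefer group indexed by I. *)
Definition prufer_sum I (h : Y) := [/\ exists s : seq X, forall b, b \notin s -> h b = 0,
  forall b, ~ I b -> h b = 0 & forall b, prufer p (h b)].

Lemma prufer_sum0 I : prufer_sum I 0.
Proof.
by split=> [|//|b]; [exists [::] | exact: prufer0].
Qed.

Lemma prufer_sumB I g h : prufer_sum I g -> prufer_sum I h -> prufer_sum I (g - h).
Proof.
move=> [[s gs] gI gp] [[t ht] hI hp]; split=> [|b Ib|b].
- exists (s ++ t) => b; rewrite mem_cat negb_or => /andP[bs bt].
  by rewrite -[LHS]/(g b - h b) gs // ht // subrr.
- by rewrite -[LHS]/(g b - h b) gI // hI // subrr.
- exact: (pruferB p_pr (gp b) (hp b)).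
Qed.

Lemma prufer_sum_delta I b t : I b -> prufer p t -> prufer_sum I (delta b t).
Proof.
move=> Ib pt; split=> [|j nj|j].
- by exists [:: b] => j; rewrite inE /delta => /negPf ->.
- by rewrite /delta; case: eqP => // e; case: nj; rewrite e.
- by rewrite /delta; case: eqP => // _; exact: prufer0.
Qed.

Lemma prufer_sum_div I h m : prufer_sum I h -> (0 < m)%N ->
  exists2 g, prufer_sum I g & g *+ m = h.
Proof.
move=> [[s hs] hI hp] m0.
have /choice[g hg] b := prufer_div p_pr (hp b) m0.
exists g; last first.
  by apply/funext => b; rewrite pmulrn fct_mulrz -pmulrn; have [] := hg b.
split=> [|b Ib|b]; last by have [] := hg b.
- by exists s => b bs; have [_ _] := hg b; apply; exact: hs.
- by have [_ _] := hg b; apply; exact: hI.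
Qed.

(** A direct sum of Pruefer groups is divisible, hence injective: a maximal
    partial homomorphism is total. *)
Lemma total_extension C B : independent C B -> exists F : X -> Y,
  [/\ forall x y, F (x + y) = F x + F y, forall c, C c -> F c = 0,
      forall b, B b -> F b = delta b t1 & forall x, prufer_sum B (F x)].
Proof.
move=> iB; have [S [SV fS maxS]] :=
  max_functional [set m | prufer_sum B m.2] iB.
set G := S `|` _ in fS maxS.
have sumG m : span G m -> prufer_sum B m.2.
  elim=> {m} [m [/SV //|[[b Bb <-]|[_ ->]]]||[x g] [y h] _ hg _ hh] /=.
  - by apply: prufer_sum_delta => //; exact: prufer_troot.
  - exact: prufer_sum0.
  - exact: prufer_sum0.
  - exact: prufer_sumB.
have tot x : dom G x.
  have [[n [n0 [g hg] nmin]]|nx] := pselect (exists n, [/\ (0 < n)%N, dom G (x *+ n)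
      & forall m, (0 < m)%N -> dom G (x *+ m) -> (n <= m)%N]); last first.
    have {}nx n : (0 < n)%N -> ~ dom G (x *+ n).
      move=> n0 hn; apply: nx.
      have ex : exists m, `[< (0 < m)%N /\ dom G (x *+ m) >].
        by exists n; apply/asboolP.
      case: (ex_minnP ex) => m /asboolP[m0 hm] mmin; exists m; split => // k k0 hk.
      by apply: mmin; apply/asboolP.
    exists 0; apply: span_in; left; apply: maxS; first exact: prufer_sum0.
    move=> h /span_setU1 [[u g] [k [hs]]]; rewrite pair_mulrz /= mul0rz.
    move=> -[/esym e1 ->]; rewrite addr0.
    suff k0 : k = 0.
      by apply: fS; move: hs; rewrite -e1 k0 mulr0z addr0.
    have xk : x *~ k = - u by apply/eqP; rewrite -addr_eq0 addrC e1.
    have H (n : nat) : dom G (x *~ n) -> n = 0%N.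
      by case: n => // n h'; case: (nx n.+1); rewrite // pmulrn.
    have d1 : dom G (x *~ k) by rewrite xk; exists (- g); exact: (spanN hs).
    have d2 : dom G (x *~ - k).
      by rewrite mulrNz xk opprK; exists g.
    by case: k {xk e1 hs} d1 d2 => k; [move=> /H -> | rewrite NegzE opprK => _ /H].
  have [h hh hE] := prufer_sum_div (sumG _ hg) n0.
  exists h; apply: span_in; left; apply: maxS => // h' /span_setU1.
  move=> [[u g'] [k [hs]]]; rewrite pair_mulrz /= => -[/esym e1 ->].
  have xk : x *~ k = - u by apply/eqP; rewrite -addr_eq0 addrC e1.
  have d1 : dom G (x *~ k) by rewrite xk; exists (- g'); exact: (spanN hs).
  have nk : (n%:Z %| k)%Z.
    have n0' : n%:Z != 0 by rewrite eqz_nat -lt0n.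
    have kE := divz_eq k n%:Z.
    have r0 : (k %% n%:Z)%Z >= 0 by rewrite modz_ge0.
    have rn : (k %% n%:Z)%Z < n%:Z by rewrite ltz_pmod // ltz_nat.
    case E : (k %% n%:Z)%Z r0 rn => [r|//] _; rewrite ltz_nat => rn.
    have dr : dom G (x *+ r).
      have -> : x *+ r = x *~ k - (x *+ n) *~ (k %/ n%:Z)%Z.
        by rewrite [in RHS]pmulrn -mulrzA -mulrzBr [n%:Z * _]mulrC {1}kE addrAC
          subrr add0r E -pmulrn.
      apply: dom_span; apply: spanB; first exact: span_in.
      by apply: spanMz; apply: span_in; exists g.
    apply/dvdz_mod0P; rewrite E; case: (posnP r) => [-> //|rpos].
    by have := nmin r rpos dr; rewrite leqNgt rn.
  apply: fS; case/dvdzP: nk => q kE.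
  have := spanD hs (spanMz q hg); rewrite pair_mulrz /=.
  rewrite /= in hE; rewrite -hE !pmulrn -!mulrzA [n%:Z * q]mulrC -kE => H.
  by move: H; rewrite -[X in span G X]/(u + x *~ k, g' + h *~ k) e1.
have /choice[F hF] := tot.
exists F; split=> [x y|c Cc|b Bb|x]; last exact: (sumG _ (hF x)).
- apply: (functional_uniq fS (hF (x + y))); exact: (spanD (hF x) (hF y)).
- by apply: (functional_uniq fS (hF c)); apply: span_in; right; right.
- by apply: (functional_uniq fS (hF b)); apply: span_in; right; left; exists b.
Qed.

End Independence.

Section UncountableGroup.
Variables (R : realType) (X : zmodType).
Implicit Types (B C D I : set X) (b x : X).

(** The fibers of multiplication by a prime are translates of subsets of D. *)
Lemma countable_torsion_preimage D : span D `<=` D -> countable D ->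
    (forall p, prime p -> forall x, x *+ p = 0 -> D x) ->
  forall n, (0 < n)%N -> countable [set x | D (x *+ n)].
Proof.
move=> sD cD tD n n0.
suff H m (E : set X) : (0 < m)%N -> countable E -> countable [set x | E (x *+ m)].
  exact: H.
elim/ltn_ind: m E => m IH E m0 cE.
have [m1|m1] := leqP m 1%N.
  have -> : m = 1%N by apply/eqP; rewrite eqn_leq m1 m0.
  by apply: countable_sub cE => x /=; rewrite mulr1n.
have p_pr := pdiv_prime m1; set p := pdiv m in p_pr.
have /dvdnP[k mE] : (p %| m)%N := pdiv_dvd m.
have k0 : (0 < k)%N by move: m0; rewrite mE muln_gt0 => /andP[].
have km : (k < m)%N by rewrite mE -[X in (X < _)%N]muln1 ltn_pmul2l // prime_gt1.
pose E' := [set z | E (z *+ k)].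
have cE' : countable E' by exact: IH.
have /choice[r hr] : forall e : X, exists x, forall y, y *+ p = e -> x *+ p = e.
  move=> e; have [[x hx]|h] := pselect (exists x : X, x *+ p = e); first by exists x.
  by exists 0 => y hy; case: h; exists y.
apply: (@countable_sub _ _ ((fun q => r q.1 + q.2) @` (E' `*` D))); last first.
  by apply: countable_image; exact: countableX.
move=> x /= Ex; exists (x *+ p, x - r (x *+ p)) => /=; last by rewrite addrC subrK.
split => /=; first by rewrite /E' /= -mulrnA mulnC -mE.
by apply: (tD p p_pr); rewrite mulrnBl (hr _ x erefl) subrr.
Qed.

(** Either some X / pX is uncountable modulo C0, and a basis of that vector
    space will do; or X is divisible modulo a countable C. In the second case,
    if for each p a maximal independent set were countable, then a countable
    subgroup D would contain all their domains. By maximality, D would contain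
    all elements of prime order and a positive multiple of each element, and X
    would be countable. *)
Lemma uncountable_independent C0 : ~ countable [set: X] -> countable C0 ->
  exists p C B, [/\ [/\ prime p, span C `<=` C & C0 `<=` C],
    independent R p C B, ~ countable B &
    (forall x, C (x *+ p)) \/
    (forall x, exists c y, C c /\ x = c + y *+ p)].
Proof.
move=> uX cC0.
pose big p := forall S : set X, countable S ->
  ~ (forall x, exists s c y, [/\ S s, span C0 c & x = s + c + y *+ p]).
have [[p [p_pr hp]]|small] := pselect (exists p, prime p /\ big p).
- pose C := [set x | exists c y, span C0 c /\ x = c + y *+ p].
  have sC : span C `<=` C.
    move=> x; elim=> {x} [//||x y _ [c [u [hc ->]]] _ [d [v [hd ->]]]].
      by exists 0, 0; rewrite mul0rn addr0; split => //; exact: span0.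
    exists (c - d), (u - v); split; first exact: spanB.
    by rewrite mulrnBl opprD addrACA.
  have Cp x : C (x *+ p) by exists 0, x; rewrite add0r; split => //; exact: span0.
  have C0C : C0 `<=` C.
    by move=> c Cc; exists c, 0; rewrite mul0rn addr0; split => //; exact: span_in.
  have [B [iB maxB]] := max_independent R p sC.
  exists p, C, B; split=> //; last by left.
  move=> cB; apply: (hp (span B) (countable_span cB)) => x.
  have [h hx] : dom_ind R p C B x.
    apply: contrapT => nx; apply: (nx); exists (delta x (troot R p 1)).
    apply: span_in; left; exists x => //; apply: maxB.
    exact: (independentU1_torsion p_pr).
  have {hx} : exists s c, [/\ span B s, C c & x = s + c].
    have -> : x = (x, h).1 by [].
    move: (x, h) hx => m {x h}.
    elim=> {m} [m [[b Bb <-]|[Cm _]]||m n _ [s [c [hs hc e1]]] _ [t [d [ht hd e2]]]] /=.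
    + exists b, 0; rewrite addr0; split => //; first exact: span_in.
      by apply: sC; exact: span0.
    + by exists 0, m.1; rewrite add0r; split => //; exact: span0.
    + by exists 0, 0; rewrite addr0; split; [exact: span0 | apply: sC; exact: span0 |].
    + exists (s - t), (c - d); rewrite e1 e2 opprD addrACA.
      split => //; first exact: spanB.
      by apply: sC; apply: spanB; exact: span_in.
  by move=> [s [c [hs [c' [y [hc' ->]]] ->]]]; exists s, c', y; rewrite addrA.
- have /choice[S hS] : forall p, exists S : set X, countable S /\ (prime p ->
      forall x, exists s c y, [/\ S s, span C0 c & x = s + c + y *+ p]).
    move=> p; have [p_pr|np] := pselect (prime p); last by exists set0; split.
    apply: contrapT => h; apply: small; exists p; split => // S cS hS.
    by apply: h; exists S.
  pose C := span (\bigcup_p S p `|` C0).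
  have sC : span C `<=` C by exact: span_sub.
  have cC : countable C.
    apply: countable_span; apply: countableU => //.
    by apply: bigcup_countable => // p _; have [] := hS p.
  have C0C : C0 `<=` C by move=> c Cc; apply: span_in; right.
  have divC p : prime p -> forall x, exists c y, C c /\ x = c + y *+ p.
    move=> p_pr x; have [_ /(_ p_pr x)[s [c [y [Ss hc ->]]]]] := hS p.
    exists (s + c), y; split => //; apply: spanD.
      by apply: span_in; left; exists p.
    by apply: span_mono hc => z; right.
  have /choice[B hB] : forall p, exists B, independent R p C B /\
      forall x, independent R p C ([set x] `|` B) -> B x.
    by move=> p; exact: max_independent.
  have [[p [p_pr uB]]|cB] := pselect (exists p, prime p /\ ~ countable (B p)).
    exists p, C, (B p); split => //; first by have [] := hB p.
    by right; exact: divC.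
  have {}cB p : prime p -> countable (B p).
    by move=> p_pr; apply: contrapT => h; apply: cB; exists p.
  exfalso.
  pose D := span (\bigcup_(p in [set p | prime p]) dom_ind R p C (B p)).
  have sD : span D `<=` D by exact: span_sub.
  have cD : countable D.
    apply: countable_span; apply: bigcup_countable => // p p_pr.
    by apply: countable_dom => //; exact: cB.
  have domD p x : prime p -> dom_ind R p C (B p) x -> D x.
    by move=> p_pr hx; apply: span_in; exists p.
  have maxD p x : prime p -> independent R p C ([set x] `|` B p) -> D x.
    move=> p_pr ix; apply: (domD p) => //; exists (delta x (troot R p 1)).
    by apply: span_in; left; exists x => //; have [_] := hB p; exact.
  have finD x : exists2 n, (0 < n)%N & D (x *+ n).
    apply: contrapT => nx; apply: (nx); exists 1%N => //; rewrite mulr1n.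
    have p_pr : prime 2 by [].
    apply: (maxD 2%N) => //; have [iB _] := hB 2%N.
    apply: (independentU1_free p_pr) => // n n0 hn; apply: nx; exists n => //.
    exact: (domD 2%N).
  have torD p : prime p -> forall x, x *+ p = 0 -> D x.
    move=> p_pr x px; have [hx|nx] := pselect (dom_ind R p C (B p) x).
      exact: (domD p).
    apply: (maxD p) => //; have [iB _] := hB p.
    apply: (independentU1_torsion p_pr) => //; rewrite px; exact: span0.
  apply: uX; apply: (@countable_sub _ _
    (\bigcup_(n in [set n | (0 < n)%N]) [set x | D (x *+ n)])).
    by move=> x _; have [n n0 Dn] := finD x; exists n.
  by apply: bigcup_countable => // n n0; exact: countable_torsion_preimage.
Qed.

(** An uncountable abelian group maps onto an uncountable direct sum of copies
    of Z(p), or of Z(p^oo), and the map may be chosen to vanish on any given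
    countable set. In the first case lv is true, and only the levels n <= 1, that
    is, elements of order at most p, occur. Surjectivity is stated for the
    generators; in the second case it follows from divisibility, since the image
    contains the elements of order p. *)
Theorem uncountable_prufer_quotient C0 : ~ countable [set: X] -> countable C0 ->
  exists p (lv : bool) I (F : X -> X -> circle R),
    let level n := lv ==> (n <= 1)%N in
  [/\ prime p /\ ~ countable I, forall x y, F (x + y) = F x + F y,
      forall c, C0 c -> F c = 0,
      forall x, [/\ exists s : seq X, forall b, b \notin s -> F x b = 0,
                    forall b, ~ I b -> F x b = 0 &
                    forall b, exists n k, level n /\ F x b = troot R p n *~ k] &
      forall b n, I b -> (0 < n)%N -> level n ->
        exists x, F x = delta b (troot R p n)].
Proof.
move=> uX cC0.
have [p [C [I [[p_pr sC C0C] iI uI [Cp|Cdiv]]]]] := uncountable_independent uX cC0;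
  have [F [FD FC FI Fsum]] := total_extension p_pr iI.
- exists p, true, I, F; split=> // [c /C0C|x|b n Ib n0 /= n1]; first exact: FC.
    have [fs Is pr] := Fsum x; split=> // b.
    have Fp : F x b *+ p = 0.
      have Fn n : F (x *+ n) = F x *+ n.
        elim: n => [|n IH]; last by rewrite !mulrS FD IH.
        by rewrite !mulr0n FC //; apply: sC; exact: span0.
      by rewrite pmulrn -fct_mulrz -pmulrn -Fn FC.
    by have [k hk] := prufer_torsion p_pr (pr b) Fp; exists 1%N, k.
  exists b; rewrite FI //; congr (delta _ (troot _ _ _)).
  by apply/eqP; rewrite eqn_leq n0 n1.
- have F0 : F 0 = 0 by apply: FC; apply: sC; exact: span0.
  have FN x : F (- x) = - F x.
    by apply: (addrI (F x)); rewrite -FD !subrr.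
  have Fz x k : F (x *~ k) = F x *~ k.
    have Fn n : F (x *+ n) = F x *+ n.
      by elim: n => [|n IH]; rewrite ?mulr0n // !mulrS FD IH.
    case: k => n; first by rewrite -!pmulrn.
    by rewrite NegzE !mulrNz -!pmulrn FN Fn.
  have Cdivn n x : exists c y, C c /\ x = c + y *+ p ^ n.
    elim: n x => [|n IH] x.
      by exists 0, x; rewrite add0r mulr1n; split => //; apply: sC; exact: span0.
    have [c [y [Cc ->]]] := IH x; have [d [z [Cd ->]]] := Cdiv y.
    exists (c + d *+ p ^ n), z; split; last first.
      by rewrite mulrnDl addrA -mulrnA -expnS.
    by apply: sC; apply: spanD; [|apply: spanMn]; exact: span_in.
  have socle (s : seq X) (h : X -> circle R) : (forall b, b \notin s -> h b = 0) ->
      (forall b, ~ I b -> h b = 0) ->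
      (forall b, exists k, h b = troot R p 1 *~ k) -> exists x, F x = h.
    elim: s h => [|a s IH] h hs hI hk.
      by exists 0; rewrite F0; apply/funext => b; rewrite hs.
    have [k hak] := hk a.
    have [Ia|nIa] := pselect (I a); last first.
      apply: IH => // b bs; have [->|ba] := eqVneq b a; first exact: hI.
      by apply: hs; rewrite inE (negPf ba).
    have [||b|x hx] := IH (h - delta a (troot R p 1) *~ k).
    + move=> b bs; rewrite delta_mulrz -[LHS]/(h b - delta a _ b) /delta.
      case: eqP => [->|/eqP ba]; first by rewrite hak subrr.
      by rewrite hs ?subrr // inE (negPf ba).
    + move=> b nIb; rewrite delta_mulrz -[LHS]/(h b - delta a _ b) /delta.
      case: eqP => [e|_]; first by case: nIb; rewrite e.
      by rewrite hI // subrr.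
    + rewrite delta_mulrz -[(_ - _) b]/(h b - delta a _ b) /delta.
      have [l ->] := hk b; case: eqP => _; last by exists l; rewrite subr0.
      by exists (l - k); rewrite mulrzBr.
    by exists (x + a *~ k); rewrite FD Fz (FI a) // hx subrK.
  have onto n (h : X -> circle R) : prufer_sum p I h -> h *+ p ^ n = 0 ->
      exists x, F x = h.
    elim: n h => [|n IH] h [[s hs] hI hp] hn.
      by exists 0; rewrite F0 -hn mulr1n.
    have hE m b : (h *+ m) b = h b *+ m by rewrite pmulrn fct_mulrz -pmulrn.
    have [||b|w hw] := socle s (h *+ p ^ n).
    + by move=> b bs; rewrite hE hs // mul0rn.
    + by move=> b bI; rewrite hE hI // mul0rn.
    + rewrite hE; apply: prufer_torsion => //.
        by have [m [k ->]] := hp b; exists m, (k * (p ^ n)%N%:Z); rewrite mulrzA pmulrn.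
      by rewrite -mulrnA -expnSr -hE hn.
    have [c [y [Cc wE]]] := Cdivn n w.
    have [||x hx] := IH (h - F y).
    + apply: (prufer_sumB p_pr); last exact: Fsum.
      by split => //; exists s.
    + by rewrite mulrnBl -hw wE FD FC // add0r pmulrn Fz -pmulrn subrr.
    + by exists (x + y); rewrite FD hx subrK.
  exists p, false, I, F; split=> // [c /C0C|x|b n Ib n0 _]; first exact: FC.
    have [fs Is pr] := Fsum x; split=> // b.
    by have [n [k ->]] := pr b; exists n, k.
  apply: (onto n); first by apply: prufer_sum_delta => //; exact: prufer_troot.
  rewrite pmulrn delta_mulrz; apply/funext => j; rewrite /delta; case: eqP => // _.
  by apply/eqP; rewrite troot_eq0z.
Qed.

End UncountableGroup.

(** * Radial locally essential subgroups *)

Lemma well_order_total (D : Type) (le : rel D) :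
  wochoice.well_order le -> forall x y, le x y \/ le y x.
Proof.
move=> wo x y.
have [|z [[]]] := wo [pred z | `[< z = x \/ z = y >]].
  by exists x; apply/asboolP; left.
by move=> /asboolP[->|->] h _; [left|right]; apply: h; apply/asboolP; [right|left].
Qed.

(** In a well-ordered net of points of finite support, at most countably many
    coordinates can be eventually nonzero: otherwise, take infinitely many of
    them; the indices from which they are nonzero are cofinal, since no point has
    infinite support, so that each coordinate is nonzero at one of countably many
    points of the net. *)
Lemma countable_eventual_support (D : Type) (le : rel D) (X : eqType)
    (I : set X) (P : D -> X -> Prop) :
    (forall x y, le x y \/ le y x) ->
    (forall d, exists s : seq X, forall b, I b -> P d b -> b \in s) ->
    (forall b, I b -> exists c, forall d, le c d -> P d b) ->
  countable I.
Proof.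
move=> tot fin ev; apply: contrapT => uI.
have infI : infinite_set I by move=> /finite_set_countable.
have [f fI finj] : exists2 f : nat -> X, forall k, I (f k) & injective f.
  have /infiniteP/card_leP[e] := infI.
  exists (fun k => \val (e (exist _ k (mem_set Logic.I)))).
    by move=> k; exact: set_valP.
  move=> k l /val_inj kl; have := @inj _ _ _ e _ _ _ _ kl.
  by rewrite !in_setT => /(_ isT isT) [].
have /choice[c hc] : forall k : nat, exists c, forall d, le c d -> P d (f k).
  by move=> k; exact: ev.
have finS d : finite_set [set b | I b /\ P d b].
  have [s hs] := fin d.
  by apply: (sub_finite_set _ (finite_seq s)) => b [Ib Pb]; exact: hs.
apply: uI; apply: (@countable_sub _ _ (\bigcup_k [set b | I b /\ P (c k) b])).
  move=> b Ib; have [cb hcb] := ev b Ib.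
  have [[k hk]|nk] := pselect (exists k, le cb (c k)).
    by exists k => //; split => //; exact: hcb.
  exfalso; apply: infinite_nat.
  have -> : [set: nat] = f @^-1` [set b | I b /\ P cb b].
    apply/seteqP; split => // k _; split => //; apply: hc.
    by have [//|h] := tot (c k) cb; case: nk; exists k.
  by apply: finite_preimage (finS cb) => k l _ _; exact: finj.
by apply: bigcup_countable => // k _; exact: finite_set_countable.
Qed.

(** The greatest common divisor of nu and p^M is a power of p that p^n does not
    divide. *)
Lemma exists_multiple_mod (p n M : nat) (nu : int) : prime p ->
  ~~ ((p ^ n)%N%:Z %| nu)%Z ->
  exists u : int, ((p ^ M)%N%:Z %| u * nu - (p ^ n.-1)%N%:Z)%Z.
Proof.
move=> p_pr hn.
have n0 : (0 < n)%N by case: n hn => //; rewrite expn0 dvd1z.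
have [u [v uv]] := Bezoutz nu (p ^ M)%N%:Z.
have : (gcdn `|nu| (p ^ M) %| p ^ M)%N by exact: dvdn_gcdr.
case/(dvdn_pfactor _ _ p_pr) => i iM gE.
have gE' : gcdz nu (p ^ M)%N%:Z = (p ^ i)%N%:Z by rewrite /gcdz /= gE.
have i_lt : (i < n)%N.
  rewrite ltnNge; apply/negP => ni; move/negP: hn; apply.
  rewrite dvdzE /=; apply: (@dvdn_trans (p ^ i)); first exact: dvdn_exp2l.
  by rewrite -gE dvdn_gcdl.
exists (u * (p ^ (n.-1 - i))%N%:Z); apply/dvdzP.
exists (- (v * (p ^ (n.-1 - i))%N%:Z)).
have -> : (p ^ n.-1)%N%:Z = (p ^ (n.-1 - i))%N%:Z * (u * nu + v * (p ^ M)%N%:Z).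
  by rewrite uv gE' -PoszM -expnD subnK // -ltnS prednK.
by ring.
Qed.

Section Multiple.
Variables (R : realType) (K : topologicalZmodType).
Local Notation X := (character R K).
Implicit Types (chi : X) (x : K).

Lemma charMz chi x k : chi (x *~ k) = chi x *~ k.
Proof.
case: k => n; first by rewrite -!pmulrn charMn.
by rewrite NegzE !mulrNz -!pmulrn charN charMn.
Qed.

(** If u is the evaluation at k and has torsion values, these are the points x of
    the closed subgroup generated by k. *)
Definition near_multiple (u : X -> circle R) x :=
  forall s : seq X, exists n : int, forall chi, chi \in s -> chi x = u chi *~ n.

Lemma closed_exists_lt n (P : nat -> set K) : (forall i, closed (P i)) ->
  closed [set x | exists2 i, (i < n)%N & P i x].
Proof.
move=> cP; elim: n => [|n IH].
  have -> : [set x | exists2 i, (i < 0)%N & P i x] = set0.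
    by apply/seteqP; split => x // [].
  exact: closed0.
have -> : [set x | exists2 i, (i < n.+1)%N & P i x]
    = [set x | exists2 i, (i < n)%N & P i x] `|` P n.
  apply/seteqP; split => x.
    move=> [i]; rewrite ltnS leq_eqVlt => /orP[/eqP -> Pn|lt Pi]; first by right.
    by left; exists i.
  by move=> [[i lt Pi]|Pn]; [exists i => //; exact: ltnW | exists n].
exact: closedU.
Qed.

Lemma closed_forall_seq (s : seq X) (P : X -> set K) :
  (forall chi, closed (P chi)) -> closed [set x | forall chi, chi \in s -> P chi x].
Proof.
move=> cP; have -> : [set x | forall chi, chi \in s -> P chi x]
    = \bigcap_(chi in [set` s]) P chi.
  by apply/seteqP; split => x h chi; apply: h.
by apply: closed_bigI => chi _; exact: cP.
Qed.

(** When u has torsion values, finitely many multiples suffice on a given finite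
    set of characters. *)
Lemma closed_near_multiple (u : X -> circle R) :
    (forall chi, exists2 m, (0 < m)%N & u chi *+ m = 0) ->
  closed (near_multiple u).
Proof.
move=> tor.
have -> : near_multiple u = \bigcap_(s in [set: seq X])
    [set x | exists n : int, forall chi, chi \in s -> chi x = u chi *~ n].
  by apply/seteqP; split => x h s; [move=> _|]; exact: h.
apply: closed_bigI => s _.
have [M M0 hM] : exists2 M, (0 < M)%N & forall chi, chi \in s -> u chi *+ M = 0.
  elim: s => [|chi s [M M0 hM]]; first by exists 1%N.
  have [m m0 hm] := tor chi; exists (m * M)%N; first by rewrite muln_gt0 m0.
  move=> psi; rewrite inE => /orP[/eqP ->|ps]; first by rewrite mulrnA hm mul0rn.
  by rewrite mulnC mulrnA hM // mul0rn.
have -> : [set x | exists n : int, forall chi, chi \in s -> chi x = u chi *~ n]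
  = [set x | exists2 i, (i < M)%N & forall chi, chi \in s -> chi x = u chi *+ i].
  apply/seteqP; split => x; last by move=> [i _ h]; exists i%:Z => chi /h ->.
  move=> [n hn].
  have M0' : M%:Z != 0 by rewrite eqz_nat -lt0n.
  have := ltz_pmod n (_ : 0 < M%:Z); rewrite ltz_nat => /(_ M0).
  have := modz_ge0 n M0'; have := divz_eq n M%:Z.
  case: (n %% M%:Z)%Z => // r nE _; rewrite ltz_nat => rM.
  exists r => // chi cs; rewrite hn // nE mulrzDr mulrC mulrzA.
  by rewrite -pmulrn hM // mul0rz add0r.
apply: (@closed_exists_lt M (fun i => [set x | forall chi, chi \in s -> chi x = u chi *+ i])).
move=> i; apply: (@closed_forall_seq s (fun chi => [set x | chi x = u chi *+ i])).
by move=> chi; exact: closed_char_eq.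
Qed.

Lemma near_multipleB u x y :
  near_multiple u x -> near_multiple u y -> near_multiple u (x - y).
Proof.
move=> hx hy s; have [n hn] := hx s; have [m hm] := hy s.
by exists (n - m) => chi cs; rewrite charD charN hn // hm // mulrzBr.
Qed.

Lemma near_multiple0 u : near_multiple u 0.
Proof. by move=> s; exists 0 => chi _; rewrite char0 mulr0z. Qed.

End Multiple.

Lemma sum_support (M : nmodType) (X : eqType) (f : X -> M) (s t : seq X) :
  uniq s -> uniq t -> (forall b, b \notin s -> f b = 0) ->
  (forall b, b \notin t -> f b = 0) -> \sum_(b <- s) f b = \sum_(b <- t) f b.
Proof.
move=> us ut fs ft.
have E (u v : seq X) : (forall b, b \notin v -> f b = 0) ->
    \sum_(b <- u) f b = \sum_(b <- [seq b <- u | b \in v]) f b.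
  move=> fv; rewrite big_filter [RHS]big_mkcond /=; apply: eq_bigr => b _.
  by case: ifPn => // /fv.
rewrite (E s t) // (E t s) //; apply: perm_big; apply: uniq_perm.
- exact: filter_uniq.
- exact: filter_uniq.
- by move=> b; rewrite !mem_filter andbC.
Qed.

Section DualCountable.
Variables (R : realType) (K : topologicalZmodType).
Hypothesis K_hausdorff : hausdorff_space K.
Hypothesis K_compact : compact [set: K].
Variable G : set K.
Hypothesis G_subgroup : is_subgroup G.
Hypothesis G_essential : locally_essential G.
Hypothesis G_radial : radial (set_type G).
Local Notation X := (character R K).
Implicit Types (chi : X) (x y : K).

Let G0 : G 0.
Proof. by have [/set_mem] := G_subgroup. Qed.

Let GB x y : G x -> G y -> G (x - y).
Proof.
by move=> Gx Gy; have [_ h] := G_subgroup; apply/set_mem/h; exact: mem_set.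
Qed.

Let span_G (A : set K) : A `<=` G -> span A `<=` G.
Proof. by move=> AG x; elim=> {x} [x /AG //||x y _ hx _ hy]; [exact: G0 | exact: GB]. Qed.

(** The closed subgroup generated by k is killed by s0, like k, so it is
    contained in V. *)
Let essential_multiple (V : set K) (s0 : seq X) (u : X -> circle R) (k : K) :
    (forall N : set K, is_subgroup N -> closed N -> N `<=` V ->
      G `&` N = [set 0] -> N = [set 0]) ->
    (forall x, (forall chi, chi \in s0 -> chi x = 0) -> V x) ->
    (forall chi, chi \in s0 -> u chi = 0) ->
    (forall chi, exists2 m, (0 < m)%N & u chi *+ m = 0) ->
    (forall chi, chi k = u chi) -> k != 0 ->
  exists g, [/\ G g, g != 0 & near_multiple u g].
Proof.
move=> ess sV us0 tor ku k0.
have sub : is_subgroup (near_multiple (K := K) u).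
  split; first by apply: mem_set; exact: near_multiple0.
  by move=> x y /set_mem hx /set_mem hy; apply/mem_set/near_multipleB.
apply: contrapT => hG.
have N0 : near_multiple u = [set 0 :> K].
  apply: ess => //; first exact: closed_near_multiple.
    move=> x hx; apply: sV => chi cs; have [n hn] := hx s0.
    by rewrite hn // us0 // mul0rz.
  apply/seteqP; split => [x [Gx hx]|x ->]; last first.
    by split=> //; exact: near_multiple0.
  by apply/eqP/negPn/negP => x0; apply: hG; exists x.
have : near_multiple u k by move=> s; exists 1 => chi _; rewrite mulr1z ku.
by rewrite N0 => /eqP; rewrite (negPf k0).
Qed.

Lemma dual_countable : countable [set: X].
Proof.
apply: contrapT => uX.
have [V V0 ess] := G_essential.
have [s0 hs0] := nbhs_characters R K_hausdorff K_compact V0.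
have {}hs0 x : (forall chi, chi \in s0 -> chi x = 0) -> V x.
  by move=> h; apply: hs0 => chi cs; rewrite h // char0.
have cs0 : countable [set` s0] by apply: finite_set_countable; exact: finite_seq.
have [p [lv [I [F [[p_pr uI] FD Fs0 Fx Fonto]]]]] :=
  uncountable_prufer_quotient R uX cs0.
pose level n := lv ==> (n <= 1)%N.
have level_max m n : level m -> level n -> level (maxn m n).
  by rewrite /level; case: (lv) => //=; rewrite geq_max => -> ->.
pose pru (t : circle R) := exists n k, level n /\ t = troot R p n *~ k.
have pru0 : pru 0.
  by exists 0%N, 0; rewrite mulr0z; split => //; rewrite /level implybT.
have up m n (k : int) : (m <= n)%N ->
    troot R p m *~ k = troot R p n *~ ((p ^ (n - m))%N%:Z * k).
  by move=> mn; have := troot_expz R p_pr (n - m) m k; rewrite subnK.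
have pruD t t' : pru t -> pru t' -> pru (t + t').
  move=> [m [k [lm ->]]] [n [l [ln ->]]].
  exists (maxn m n), ((p ^ (maxn m n - m))%N%:Z * k + (p ^ (maxn m n - n))%N%:Z * l).
  split; first exact: level_max.
  by rewrite mulrzDr -!up ?leq_maxl ?leq_maxr.
have pru_tor t : pru t -> exists m, t *+ p ^ m = 0.
  move=> [n [k [_ ->]]]; exists n; rewrite pmulrn -mulrzA mulrC mulrzA.
  have /eqP -> : troot R p n *~ (p ^ n)%N%:Z == 0 by rewrite troot_eq0z.
  by rewrite mul0rz.
have pru_tor' t : pru t -> exists2 m, (0 < m)%N & t *+ m = 0.
  by move=> /pru_tor[m hm]; exists (p ^ m)%N; rewrite ?expn_gt0 ?prime_gt0.
have prF chi b : pru (F chi b) by have [_ _] := Fx chi; exact.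
(* phi J is the homomorphism that adds up the coordinates in J, that is, the
   element of the product of copies of the p-adic integers all of whose
   coordinates in J are 1. *)
have /choice[sp hsp] : forall chi, exists s : seq X, uniq s /\
    forall b, b \notin s -> F chi b = 0.
  move=> chi; have [[s hs] _ _] := Fx chi; exists (undup s).
  by split=> [|b]; [exact: undup_uniq | rewrite mem_undup => /hs].
pose coord (J : set X) chi b : circle R := if `[< J b >] then F chi b else 0.
pose phi J chi := \sum_(b <- sp chi) coord J chi b.
have phiE J chi t : uniq t -> (forall b, b \notin t -> coord J chi b = 0) ->
    phi J chi = \sum_(b <- t) coord J chi b.
  move=> ut ht; apply: sum_support => //; first by have [] := hsp chi.
  by move=> b hb; rewrite /coord; case: asboolP => // _; have [_] := hsp chi; exact.
have phiD J chi psi : phi J (chi + psi) = phi J chi + phi J psi.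
  pose t := undup (sp chi ++ sp psi).
  have tE chi' : {subset sp chi' <= t} -> forall b, b \notin t -> F chi' b = 0.
    by move=> st b bt; have [_] := hsp chi'; apply; apply: contra bt => /st.
  have t1 := tE chi _; have t2 := tE psi _.
  have {}t1 : forall b, b \notin t -> F chi b = 0.
    by apply: t1 => b; rewrite mem_undup mem_cat => ->.
  have {}t2 : forall b, b \notin t -> F psi b = 0.
    by apply: t2 => b; rewrite mem_undup mem_cat orbC => ->.
  have ut : uniq t by exact: undup_uniq.
  rewrite !(@phiE J _ t) //; last 3 first.
  - by move=> b bt; rewrite /coord t2 // if_same.
  - by move=> b bt; rewrite /coord t1 // if_same.
  - move=> b bt; rewrite /coord FD -[(F chi + F psi) b]/(F chi b + F psi b).
    by rewrite t1 // t2 // addr0 if_same.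
  rewrite -big_split /=; apply: eq_bigr => b _; rewrite /coord FD.
  by case: asboolP => // _; rewrite addr0.
have pr_phi J chi : pru (phi J chi).
  rewrite /phi; elim: (sp chi) => [|b s IH]; first by rewrite big_nil.
  rewrite big_cons; apply: pruD => //; rewrite /coord.
  by case: asboolP.
have phi1 J chi b t : F chi = delta b t -> phi J chi = if `[< J b >] then t else 0.
  move=> Fb; rewrite (@phiE J chi [:: b]) //; last first.
    move=> j; rewrite inE /coord Fb /delta => /negPf ->; exact: if_same.
  by rewrite big_seq1 /coord Fb /delta eqxx.
have level1 : level 1 by rewrite /level implybT.
(* G has a nonzero point in the closed subgroup generated by the point that
   evaluates to phi J: a p-adic multiple nu of it, with nu nonzero modulo some
   p^n. *)
have point J : (exists2 b, I b & J b) -> exists g n, [/\ G g, (0 < n)%N, level n &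
    forall s : seq X, exists nu : int,
      (forall chi, chi \in s -> chi g = phi J chi *~ nu) /\
      ~~ ((p ^ n)%N%:Z %| nu)%Z].
  move=> [b Ib Jb].
  have [k hk] := evaluation_surjective K_compact (phiD J).
  have k0 : k != 0.
    have [chi hchi] := Fonto b 1%N Ib isT level1.
    apply/eqP => k0; have := hk chi; rewrite k0 char0 (phi1 _ _ _ _ hchi) asboolT //.
    by move=> /eqP; rewrite eq_sym (negPf (troot1_neq0 R p_pr)).
  have [||g [Gg g0 hg]] := essential_multiple ess hs0 _ _ hk k0.
  - move=> chi cs; rewrite /phi big1 // => c _; rewrite /coord Fs0 //.
    by rewrite if_same.
  - by move=> chi; exact: pru_tor'.
  have [chi0 hchi0] := characters_separate R K_hausdorff K_compact g0.
  have [n [j [ln nE]]] := pr_phi J chi0.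
  have key (s : seq X) : exists nu : int, (forall chi, chi \in s -> chi g = phi J chi *~ nu) /\
      ~~ ((p ^ n)%N%:Z %| nu)%Z.
    have [nu hnu] := hg (chi0 :: s); exists nu; split.
      by move=> chi cs; apply: hnu; rewrite inE cs orbT.
    apply: contra hchi0; rewrite hnu ?mem_head // nE -(troot_eq0z R p_pr).
    by rewrite -mulrzA mulrC mulrzA => /eqP ->; rewrite mul0rz.
  exists g, n; split => //; case: n {ln nE} key => // key.
  by have [nu []] := key [::]; rewrite expn0 dvd1z.
have /choice[q hq] : forall b, exists q : K * nat, I b ->
    [/\ G q.1, (0 < q.2)%N, level q.2 & forall s : seq X, exists nu : int,
      (forall chi, chi \in s -> chi q.1 = F chi b *~ nu) /\
      ~~ ((p ^ q.2)%N%:Z %| nu)%Z].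
  move=> b; have [Ib|nb] := pselect (I b); last by exists (0, 0%N).
  have [|g [n [Gg n0 ln key]]] := point [set b]; first by exists b.
  exists (g, n) => _; split => //= s; have [nu [h1 h2]] := key s; exists nu; split=> //.
  move=> chi cs; rewrite h1 //; congr (_ *~ _).
  have coord0 j : j != b -> coord [set b] chi j = 0.
    by move=> /eqP jb; rewrite /coord asboolF.
  have coordb : coord [set b] chi b = F chi b by rewrite /coord asboolT.
  rewrite (@phiE _ _ [:: b]) ?big_seq1 // => j; rewrite inE; exact: coord0.
(* The level n at which the multiple in G of the b-th coordinate vector is
   nonzero can be taken constant on an uncountable set. *)
have [n uI'] : exists n, ~ countable [set b | I b /\ (q b).2 = n].
  apply: contrapT => h; apply: uI.
  apply: (@countable_sub _ _ (\bigcup_n [set b | I b /\ (q b).2 = n])).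
    by move=> b Ib; exists (q b).2.
  apply: bigcup_countable => // n _; apply: contrapT => h'.
  by apply: h; exists n.
set I' := [set b | _] in uI'.
have [b0 Ib0] : exists b, I' b.
  apply: contrapT => h; apply: uI'.
  by apply: (@countable_sub _ _ set0) => // b Ib; case: h; exists b.
have n0 : (0 < n)%N by have [Ib <-] := Ib0; have [] := hq _ Ib.
have ln : level n by have [Ib <-] := Ib0; have [] := hq _ Ib.
have [|x [N [Gx N0 lN key]]] := point I'; first by exists b0 => //; case: Ib0.
(* The (n-1)st power of p makes the coordinates of x multiples of those of the
   chosen points of G. *)
pose y := x *+ p ^ n.-1.
have GMn z m : G z -> G (z *+ m).
  move=> Gz; elim: m => [|m IH]; first by rewrite mulr0n.
  by rewrite mulrS -[z *+ m]opprK; apply: GB => //; rewrite -sub0r; exact: GB.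
have Gy : G y by exact: GMn.
have lNn : level (N + n.-1)%N.
  move: ln lN; rewrite /level; case: (lv) => //=.
  by move: n0 N0; case: (n) => [|[]]; case: (N) => [|[]].
(* test b sees only the b-th coordinate, at a level where y is nonzero. *)
have /choice[test htest] : forall b, exists chi, I' b ->
    F chi = delta b (troot R p (N + n.-1)).
  move=> b; have [[Ib _]|nb] := pselect (I' b); last by exists 0.
  have [|chi hchi] := Fonto b (N + n.-1)%N Ib _ lNn; first by rewrite addn_gt0 N0.
  by exists chi.
have test_y b : I' b -> test b y != 0.
  move=> Ib; have [mu [hmu hN]] := key [:: test b].
  rewrite /y charMn hmu ?mem_head // (phi1 _ _ _ _ (htest b Ib)) asboolT //.
  rewrite pmulrn -mulrzA mulrC addnC (troot_expz R p_pr).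
  by rewrite (troot_eq0z R p_pr).
pose A := span [set (q b).1 | b in I'].
have AG : A `<=` G.
  by apply: span_G => z [c [Ic _] <-]; have [] := hq c Ic.
have A_fin a : A a -> exists s : seq X, forall b, I' b -> test b a != 0 -> b \in s.
  elim=> {a} [z [c [Ic cn] <-]||a a' _ [s hs] _ [t ht]].
  - exists [:: c] => j Ij; apply: contraR; rewrite inE => jc.
    have [_ _ _ /(_ [:: test j])[nu [hnu _]]] := hq _ Ic.
    have /negPf cj : c != j by rewrite eq_sym.
    by rewrite hnu ?mem_head // htest // /delta cj mul0rz eqxx.
  - by exists [::] => b _; rewrite char0 eqxx.
  - exists (s ++ t) => b Ib; rewrite charD charN mem_cat; apply: contraR.
    rewrite negb_or => /andP[bs bt].
    have /eqP -> : test b a == 0 by apply: contraR bs => /(hs _ Ib).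
    have /eqP -> : test b a' == 0 by apply: contraR bt => /(ht _ Ib).
    by rewrite subrr.
(* By [nbhs_characters] this puts y in the closure of A. The finitely many
   characters in s involve finitely many coordinates, so that y can be replaced
   by a finite sum, whose terms lie in A by [exists_multiple_mod]. *)
have A_app (s : seq X) : exists2 a, A a & forall chi, chi \in s -> chi a = chi y.
  have [mu [hmu _]] := key s.
  pose t := [seq b <- undup (flatten [seq sp chi | chi <- s]) | `[< I' b >]].
  have /choice[r hr] : forall b, exists a, I' b ->
      A a /\ forall chi, chi \in s -> chi a = F chi b *+ p ^ n.-1.
    move=> b; have [Ib|nb] := pselect (I' b); last by exists 0.
    have [M hM] : exists M, forall chi, chi \in s -> F chi b *+ p ^ M = 0.
      elim: (s) => [|chi s' [M hM]]; first by exists 0%N.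
      have [m hm] := pru_tor _ (prF chi b); exists (m + M)%N => psi.
      rewrite expnD inE => /orP[/eqP ->|ps]; first by rewrite mulrnA hm mul0rn.
      by rewrite mulnC mulrnA hM // mul0rn.
    have [Ib1 bn] := Ib; have [_ _ _ /(_ s)[nu [hnu]]] := hq _ Ib1.
    rewrite bn => /(exists_multiple_mod M p_pr)[w /dvdzP[v hv]].
    exists ((q b).1 *~ w) => _; split.
      by apply: spanMz; apply: span_in; exists b.
    move=> chi cs; rewrite charMz hnu // -mulrzA [nu * w]mulrC.
    have -> : w * nu = (p ^ M)%N%:Z * v + (p ^ n.-1)%N%:Z.
      by rewrite [_ * v]mulrC -hv subrK.
    by rewrite mulrzDr mulrzA -pmulrn hM // mul0rz add0r -pmulrn.
  have It b : b \in t -> I' b by rewrite mem_filter => /andP[/asboolP].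
  exists ((\sum_(b <- t) r b) *~ mu).
    apply: spanMz; rewrite big_seq; elim/big_ind: _ => [||b /It /hr[]//].
      exact: span0.
    exact: spanD.
  move=> chi cs; rewrite charMz /y charMn hmu // (@phiE _ _ t).
  - rewrite [RHS]pmulrn -mulrzA mulrC mulrzA -pmulrn; congr (_ *~ _).
    have -> : chi (\sum_(b <- t) r b) = \sum_(b <- t) chi (r b).
      elim: (t) => [|b t' IH]; first by rewrite !big_nil char0.
      by rewrite !big_cons charD IH.
    rewrite -sumrMnl; apply: eq_big_seq => b /It Ib.
    by rewrite (hr _ Ib).2 // /coord asboolT.
  - by apply: filter_uniq; exact: undup_uniq.
  - move=> b; rewrite mem_filter /coord; case: asboolP => //= _.
    rewrite mem_undup => bt; have [_] := hsp chi; apply; apply: contra bt => bsp.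
    by apply/flattenP; exists (sp chi) => //; exact: map_f.
pose A' : set (set_type G) := [set z | A (set_val z)].
pose y' : set_type G := exist _ y (mem_set Gy).
have cl : closure A' y'.
  move=> W; rewrite nbhsE => -[W' [[U oU UW'] W'y] W'W].
  have Uy : nbhs y U.
    by apply: open_nbhs_nbhs; split => //; move: W'y; rewrite -UW'.
  have [s hs] := nbhs_characters R K_hausdorff K_compact Uy.
  have [a Aa ha] := A_app s; have Ga := AG _ Aa.
  exists (exist _ a (mem_set Ga)); split => //; apply: W'W; rewrite -UW'.
  exact: hs.
have [D [le [a [wo Aa conv]]]] := G_radial cl.
apply: uI'; apply: (@countable_eventual_support D le X I'
  (fun d b => test b (set_val (a d)) != 0)).
- exact: well_order_total.
- by move=> d; exact: A_fin (Aa d).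
move=> b Ib; have [||c hc] := conv [set z : set_type G | test b (set_val z) != 0].
- by exists [set z | test b z != 0] => //; exact: open_char_neq0.
- exact: test_y.
by exists c => d /hc.
Qed.

End DualCountable.

(** * Metrizability *)

Section Chord.
Variable R : realType.
Implicit Types s t : circle R.

(** The distance from t to 0 in the plane, up to a factor sqrt 2. *)
Definition chord t : R := Num.sqrt (1 - cre t).

Lemma chord_ge0 t : 0 <= chord t. Proof. exact: sqrtr_ge0. Qed.

Lemma chord_le2 t : chord t <= 2.
Proof.
rewrite -[leRHS]gtr0_norm // -sqrtr_sqr ler_sqrt.
  by have := cre_norm t; rewrite ler_norml => /andP[]; lra.
exact: sqr_ge0.
Qed.

Lemma chordN t : chord (- t) = chord t.
Proof. by rewrite /chord creN. Qed.

Lemma chord0 : chord 0 = 0.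
Proof. by rewrite /chord cre0 subrr sqrtr0. Qed.

Lemma chord_eq0 t : chord t = 0 -> t = 0.
Proof.
move=> /eqP; rewrite sqrtr_eq0 subr_le0 => h.
by apply/cre_eq1/eqP; rewrite eq_le cre_le1.
Qed.

Lemma chordD s t : chord (s + t) <= chord s + chord t.
Proof.
have s0 : 0 <= 1 - cre s by rewrite subr_ge0 cre_le1.
have t0 : 0 <= 1 - cre t by rewrite subr_ge0 cre_le1.
have p0 := mulr_ge0 (chord_ge0 s) (chord_ge0 t).
rewrite -[leRHS]ger0_norm ?addr_ge0 ?chord_ge0 // -sqrtr_sqr ler_sqrt ?sqr_ge0 //.
rewrite sqrrD /chord !sqr_sqrtr // -/(chord s) -/(chord t) creD.
have P2 : (chord s * chord t) ^+ 2 = (1 - cre s) * (1 - cre t).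
  by rewrite exprMn /chord !sqr_sqrtr.
have [/andP[s1 s2] /andP[t1 t2]] : -1 <= cre s <= 1 /\ -1 <= cre t <= 1.
  by rewrite -!ler_norml !cre_norm.
have h : cim s * cim t <= 2 * (chord s * chord t).
  have H : (cim s * cim t) ^+ 2 <= (2 * (chord s * chord t)) ^+ 2.
    rewrite exprMn [X in _ <= X]exprMn P2.
    have -> : cim s ^+ 2 = (1 - cre s) * (1 + cre s).
      by have := cre_cim1 s; lra.
    have -> : cim t ^+ 2 = (1 - cre t) * (1 + cre t).
      by have := cre_cim1 t; lra.
    rewrite mulrACA [2 ^+ 2 * _]mulrC ler_wpM2l ?mulr_ge0 //.
    by nra.
  rewrite (le_trans (ler_norm _)) // -[leRHS]ger0_norm ?mulr_ge0 ?chord_ge0 //.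
  by rewrite -ler_sqr ?nnegrE // !real_normK ?num_real.
have := mulr_ge0 s0 t0; rewrite -mulr_natl; lra.
Qed.

End Chord.

Section Metric.
Variables (R : realType) (K : topologicalZmodType).
Variable u : nat -> character R K.
Hypothesis u_sep : forall x : K, (forall n, u n x = 0) -> x = 0.

Definition dual_dist (x y : K) : R :=
  sup [set chord (u n (x - y)) / 2 ^+ n | n in [set: nat]].

Let term_le n x y : chord (u n (x - y)) / 2 ^+ n <= 2.
Proof.
rewrite ler_pdivrMr ?exprn_gt0 // (le_trans (chord_le2 _)) // ler_peMr //.
by rewrite exprn_ege1 // ler1n.
Qed.

Let has_sup_dist x y :
  has_sup [set chord (u n (x - y)) / 2 ^+ n | n in [set: nat]].
Proof.
split; first by exists (chord (u 0 (x - y)) / 2 ^+ 0), 0%N.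
by exists 2 => _ [n _ <-]; exact: term_le.
Qed.

Lemma dual_dist_ub n x y : chord (u n (x - y)) / 2 ^+ n <= dual_dist x y.
Proof. by apply: ub_le_sup; [exact: (has_sup_dist x y).2 | exists n]. Qed.

Lemma dual_dist_lub x y e : (forall n, chord (u n (x - y)) / 2 ^+ n <= e) ->
  dual_dist x y <= e.
Proof. by move=> h; apply: ge_sup; [exact: (has_sup_dist x y).1 | move=> _ [n _ <-]]. Qed.

Fact dual_distxx x : dual_dist x x = 0.
Proof.
apply/eqP; rewrite eq_le dual_dist_lub; last first.
  by move=> n; rewrite subrr char0 chord0 mul0r.
by rewrite (le_trans _ (dual_dist_ub 0 x x)) // subrr char0 chord0 mul0r.
Qed.

Fact dual_dist_positivity x y : dual_dist x y = 0 -> x = y.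
Proof.
move=> h; apply/eqP; rewrite -subr_eq0; apply/eqP/u_sep => n.
apply: chord_eq0; apply/eqP; rewrite eq_le chord_ge0 andbT.
by have := dual_dist_ub n x y; rewrite h ler_pdivrMr ?exprn_gt0 // mul0r.
Qed.

Fact dual_dist_sym x y : dual_dist x y = dual_dist y x.
Proof.
rewrite /dual_dist; congr sup; apply: eq_imagel => n _.
by rewrite -opprB charN chordN.
Qed.

Fact dual_dist_triangle y x z : dual_dist x z <= dual_dist x y + dual_dist y z.
Proof.
apply: dual_dist_lub => n.
apply: le_trans (lerD (dual_dist_ub n x y) (dual_dist_ub n y z)).
rewrite -mulrDl ler_pM2r ?invr_gt0 ?exprn_gt0 //.
have -> : x - z = (x - y) + (y - z) by rewrite addrA subrK.
by rewrite charD chordD.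
Qed.

(** K as a type indexed by the separating sequence, on which the metric
    depends. *)
Definition dual_metric of (forall x : K, (forall n, u n x = 0) -> x = 0) : Type := K.

HB.instance Definition _ := Choice.copy (dual_metric u_sep) K.
HB.instance Definition _ := isMetric.Build R (dual_metric u_sep)
  dual_distxx dual_dist_positivity dual_dist_sym dual_dist_triangle.

Lemma dual_dist_continuous : continuous (id : K -> dual_metric u_sep).
Proof.
move=> x; apply/cvg_ballP => e e0; rewrite near_simpl.
have e2 : 0 < e / 2 by rewrite divr_gt0.
have [N hN] : exists N, 2 / 2 ^+ N <= e / 2.
  exists (Num.truncn (2 / (e / 2))); set N := Num.truncn _.
  rewrite ler_pdivrMr ?exprn_gt0 // mulrC -ler_pdivrMr //.
  rewrite (le_trans (ltW (truncnS_gt _))) // -/N -natrX ler_nat.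
  exact: ltn_expl.
have near_n n : \forall y \near x, chord (u n (x - y)) <= e / 2.
  have d0 : 0 < (e / 2) ^+ 2 by rewrite exprn_gt0.
  have := nbhs_shift x (char_continuous0 (u n) d0); apply: filterS => y /= hy.
  rewrite -[e / 2]ger0_norm ?(ltW e2) // -sqrtr_sqr /chord ler_sqrt ?sqr_ge0 //.
  by rewrite -[x - y]opprB charN creN ltW.
have near_all M : \forall y \near x, forall n, (n < M)%N -> chord (u n (x - y)) <= e / 2.
  elim: M => [|M IH]; first exact: nearW.
  apply: filterS2 IH (near_n M) => y h1 h2 n; rewrite ltnS leq_eqVlt.
  by move=> /orP[/eqP ->|/h1].
apply: filterS (near_all N) => y hy.
rewrite ballEmdist /=; apply: (@le_lt_trans _ _ (e / 2)); last by rewrite gtr_pMr // invf_lt1 ?ltr1n.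
apply: dual_dist_lub => n; have [nN|Nn] := ltnP n N.
  rewrite ler_pdivrMr ?exprn_gt0 // (le_trans (hy n nN)) // ler_peMr ?(ltW e2) //.
  by rewrite exprn_ege1 // ler1n.
apply: le_trans hN; apply: ler_pM; rewrite ?chord_ge0 ?chord_le2 ?invr_ge0 ?exprn_ge0 //.
by rewrite lef_pV2 ?posrE ?exprn_gt0 // ler_weXn2l // ler1n.
Qed.

End Metric.

Lemma continuous_inverse_of_compact (R : realType) (K : topologicalType) (M : metricType R)
    (f : K -> M) (g : M -> K) : compact [set: K] -> cancel f g -> cancel g f ->
  continuous f -> continuous g.
Proof.
move=> cK fg gf cf; apply/continuousP => A oA.
have -> : g @^-1` A = ~` (f @` (~` A)).
  apply/seteqP; split => [z Agz [x nAx xz]|z nz].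
    by apply: nAx; rewrite -(fg x) xz.
  by apply: contrapT => nA; apply: nz; exists (g z).
rewrite openC; apply: compact_closed; first exact: metric_hausdorff.
apply: continuous_compact; first exact: continuous_subspaceT.
by apply: (subclosed_compact _ cK) => //; exact: open_closedC.
Qed.

Theorem theorem4p5 (R : realType) (K : topologicalZmodType)
    (K_hausdorff : hausdorff_space K) (K_compact : compact [set: K])
    (G : set K) (G_subgroup : is_subgroup G)
    (G_essential : locally_essential G)
    (G_radial : radial (set_type G)) :
  metrizable R K.
Proof.
have /countable_injP[e einj] :=
  dual_countable R K_hausdorff K_compact G_subgroup G_essential G_radial.
have /choice[u hu] : forall n, exists chi : character R K,
    forall psi, e psi = n -> psi = chi.
  move=> n; have [[chi hchi]|h] := pselect (exists chi, e chi = n).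
    by exists chi => psi hpsi; apply: einj; rewrite ?inE // hpsi.
  by exists 0 => psi hpsi; case: h; exists psi.
have u_sep (x : K) : (forall n, u n x = 0) -> x = 0.
  move=> ux; apply/eqP/negPn/negP => x0.
  have [chi] := characters_separate R K_hausdorff K_compact x0.
  by rewrite (hu _ chi erefl) ux eqxx.
exists (dual_metric u_sep), id, id.
split=> //; first exact: dual_dist_continuous.
by apply: (@continuous_inverse_of_compact R K (dual_metric u_sep) id id K_compact) => //;
  exact: dual_dist_continuous.
Qed.
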